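(* Let $q\ge 2$ be an integer. Given any $\epsilon>0$, there is a $(q+1)$-regular graph of groups $\mathbf{X}=(X,\mathcal{G})$ such that \[\lim_{m\to\infty}\frac{N_m(\mathbf{X})}{q^m}=1\] but \[|N_m(\mathbf{X})-q^m|>(q-\epsilon)^m\] for arbitrarily large $m$.
   Context: Graphs have oriented edges $e$ with source $s(e)$, target $t(e)$ and inverse $\overline{e}\neq e$. A graph of groups $\mathbf{X}=(X,\mathcal{G})$ is a graph $X$ with (here finite) groups $G_x$ (vertices), $G_e=G_{\overline e}$ (edges) and monomorphisms $G_e\to G_{t(e)}$. It is $(q+1)$-regular if its universal covering (Bass–Serre) tree $\mathcal{T}$ is $(q+1)$-regular. Its fundamental group $\Gamma=\pi_1(X,\mathcal{G})$ acts on $\mathcal{T}$ without inversions. An element $\gamma\in\Gamma$ is hyperbolic if it fixes no vertex of $\mathcal{T}$; $\ell(\gamma)=\min_x d(x,\gamma x)$ (over vertices $x$) is its translation length and $\mathrm{Axis}(\gamma)$ is the bi-infinite path of vertices attaining this minimum. It is primitive if $\gamma\ne h^r$ for all $h\in\Gamma$, $r>1$. $\Gamma_{\mathrm{Axis}(\gamma)}$ is the pointwise stabilizer of $\mathrm{Axis}(\gamma)$ in $\Gamma$, and $\mathrm{Cent}(\gamma,\Gamma_{\mathrm{Axis}(\gamma)})$ is the set of its elements commuting with $\gamma$. \[N_m(\mathbf{X})=\sum_{[\gamma]:\ \ell(\gamma)=m}\frac{\ell(\gamma_0)}{|\mathrm{Cent}(\gamma,\Gamma_{\mathrm{Axis}(\gamma)})|},\]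 where the sum runs over $\Gamma$-conjugacy classes of hyperbolic elements $\gamma\in\Gamma$ with $\ell(\gamma)=m$ and $\gamma_0$ is the primitive hyperbolic element underlying $\gamma$ (so $\gamma$ is a positive power of $\gamma_0$). The paper also writes the same quantity as $N_m=\sum_{\ell(c)=m}w(c)\ell(c_0)$, the sum over cycles $c$ (closed paths up to cyclic rotation) of length $m$ in $X$ with underlying prime cycle $c_0$, where $w(e)=|G_{s(e)}|/|G_e|$, $w(e,e')=w(e')$ if $e'\ne\overline e$, $w(e,\overline e)=w(\overline e)-1$, and $w(c)=\prod_{j\in\mathbb{Z}/n}w(e_j,e_{j+1})$ for $c=(e_1,\dots,e_n)$. *)

(* Defs.v *)
From HB Require Import structures.
From mathcomp Require Import all_boot all_order all_algebra all_fingroup.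
From mathcomp Require Import finmap.
From mathcomp Require Import all_classical all_reals all_analysis.

Set Implicit Arguments.
Unset Strict Implicit.
Unset Printing Implicit Defensive.

Local Open Scope classical_set_scope.
Local Open Scope card_scope.
Local Open Scope group_scope.
Local Open Scope quotient_scope.

(* Graphs in the sense of Serre: loops and multiple edges are allowed, and the
   graph may be infinite. *)
Record graph := Graph {
  vert : Type;
  edge : Type;
  src : edge -> vert;
  tgt : edge -> vert;
  einv : edge -> edge;
  einvK : involutive einv;
  einv_neq : forall e, einv e <> e;
  src_einv : forall e, src (einv e) = tgt e
}.

Section Graph.
Variable X : graph.

Fixpoint is_walk (x : vert X) (p : seq (edge X)) (y : vert X) : Prop :=
  if p is e :: p' then src e = x /\ is_walk (tgt e) p' y else x = y.

Definition graph_connected : Prop :=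
  inhabited (vert X) /\ forall x y, exists p, is_walk x p y.

Definition regular_graph (d : nat) : Prop :=
  forall x : vert X, [set e | src e = x] #= `I_d.

(* The least element of A, and 0 if A is empty. *)
Definition least (A : set nat) : nat :=
  xget 0%N [set n | A n /\ forall k, A k -> (n <= k)%N].

Definition dist (x y : vert X) : nat :=
  least [set size p | p in [set p | is_walk x p y]].

End Graph.

(* The monomorphism G_e -> G_(t e) is [emb e]; since G_e is G_(einv e), the
   monomorphism G_e -> G_(s e) is [emb (einv e)] precomposed with the cast
   [egrp_cast] below. *)
Record graph_of_groups := GraphOfGroups {
  base :> graph;
  vgrp : vert base -> finGroupType;
  egrp : edge base -> finGroupType;
  egrp_einv : forall e, egrp (einv e) = egrp e;
  emb : forall e, egrp e -> vgrp (tgt e);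
  embM : forall e, {morph @emb e : g h / g * h};
  emb_inj : forall e, injective (@emb e)
}.

Definition egrp_cast (X : graph_of_groups) (e : edge X) (g : egrp e) :
    egrp (einv e) :=
  eq_rect_r (fun H : finGroupType => H) g (egrp_einv e).

(* The path group F(X, G): generated by the vertex groups and the edges, subject
   to  einv e = e^-1  and  e * emb e g * e^-1 = emb (einv e) g  for g in G_e. *)
Section PathGroup.
Variable X : graph_of_groups.

Definition letter : Type := ({v : vert X & vgrp v} + edge X)%type.
Definition word : Type := seq letter.
HB.instance Definition _ := gen_eqMixin word.
HB.instance Definition _ := gen_choiceMixin word.

Definition lvert (v : vert X) (g : vgrp v) : letter := inl (Tagged (@vgrp X) g).
Definition ledge (e : edge X) : letter := inr e.

Inductive weq : word -> word -> Prop :=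
| weq_refl w : weq w w
| weq_sym w1 w2 : weq w1 w2 -> weq w2 w1
| weq_trans w1 w2 w3 : weq w1 w2 -> weq w2 w3 -> weq w1 w3
| weq_cat w1 w2 w1' w2' :
    weq w1 w1' -> weq w2 w2' -> weq (w1 ++ w2) (w1' ++ w2')
| weq_one v : weq [:: lvert (1 : vgrp v)] [::]
| weq_mul v (g h : vgrp v) : weq [:: lvert g; lvert h] [:: lvert (g * h)]
| weq_einv e : weq [:: ledge e; ledge (einv e)] [::]
| weq_conj e (g : egrp e) :
    weq [:: ledge e; lvert (emb g); ledge (einv e)]
        [:: lvert (emb (egrp_cast g))].

Definition weqb : rel word := fun w1 w2 => `[< weq w1 w2 >].

Fact weqb_refl : reflexive weqb.
Proof. by move=> w; apply/asboolP; exact: weq_refl. Qed.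

Fact weqb_sym : symmetric weqb.
Proof. by move=> w1 w2; apply/asboolP/asboolP; exact: weq_sym. Qed.

Fact weqb_trans : transitive weqb.
Proof.
by move=> w2 w1 w3 /asboolP h1 /asboolP h2; apply/asboolP; exact: weq_trans h2.
Qed.

Canonical weq_equiv := EquivRel weqb weqb_refl weqb_sym weqb_trans.

Definition path_group : Type := {eq_quot weq_equiv}.
HB.instance Definition _ := Choice.on path_group.

Definition class_of (w : word) : path_group := \pi_({eq_quot weq_equiv}) w.
Definition rep_of (x : path_group) : word :=
  @generic_quotient.repr word {eq_quot weq_equiv} x.

Lemma rep_ofK x : class_of (rep_of x) = x.
Proof. exact: reprK. Qed.

Lemma class_ofP w1 w2 : class_of w1 = class_of w2 <-> weq w1 w2.
Proof.
split=> [/eqmodP/asboolP//|h].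
by apply/eqmodP; apply/asboolP.
Qed.

Lemma rep_class w : weq (rep_of (class_of w)) w.
Proof. by apply/class_ofP; rewrite rep_ofK. Qed.

Definition linv (a : letter) : letter :=
  match a with
  | inl u => lvert (tagged u)^-1
  | inr e => ledge (einv e)
  end.

Definition winv (w : word) : word := rev (map linv w).

Lemma winv_cat w1 w2 : winv (w1 ++ w2) = winv w2 ++ winv w1.
Proof. by rewrite /winv map_cat rev_cat. Qed.

Lemma weq_linvr a : weq [:: a; linv a] [::].
Proof.
case: a => [[v g]|e] /=; last exact: weq_einv.
apply: weq_trans (weq_mul _ _) _; rewrite mulgV; exact: weq_one.
Qed.

Lemma weq_linvl a : weq [:: linv a; a] [::].
Proof.
case: a => [[v g]|e] /=.
  apply: weq_trans (weq_mul _ _) _; rewrite mulVg; exact: weq_one.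
by have := weq_einv (einv e); rewrite einvK.
Qed.

Lemma weq_winvr w : weq (w ++ winv w) [::].
Proof.
elim: w => [|a w IH]; first exact: weq_refl.
rewrite -cat1s winv_cat -catA (catA w).
apply: weq_trans (_ : weq _ ([:: a] ++ ([::] ++ winv [:: a]))) _.
  apply: weq_cat; first exact: weq_refl.
  apply: weq_cat => //; exact: weq_refl.
exact: weq_linvr.
Qed.

Lemma weq_winvl w : weq (winv w ++ w) [::].
Proof.
elim: w => [|a w IH]; first exact: weq_refl.
rewrite -cat1s winv_cat -catA (catA (winv [:: a])).
apply: weq_trans IH.
apply: weq_cat; first exact: weq_refl.
rewrite -[X in weq _ X]cat0s; apply: weq_cat; last exact: weq_refl.
exact: weq_linvl.
Qed.

Definition pg_one : path_group := class_of [::].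
Definition pg_mul (x y : path_group) : path_group :=
  class_of (rep_of x ++ rep_of y).
Definition pg_inv (x : path_group) : path_group := class_of (winv (rep_of x)).

Lemma pg_mulE w1 w2 : pg_mul (class_of w1) (class_of w2) = class_of (w1 ++ w2).
Proof. by apply/class_ofP; apply: weq_cat; exact: rep_class. Qed.

Fact pg_mulA : associative pg_mul.
Proof.
move=> x y z; rewrite -(rep_ofK x) -(rep_ofK y) -(rep_ofK z).
by rewrite !pg_mulE catA.
Qed.

Fact pg_mul1 : left_id pg_one pg_mul.
Proof. by move=> x; rewrite -(rep_ofK x) pg_mulE. Qed.

Fact pg_mulr1 : right_id pg_one pg_mul.
Proof. by move=> x; rewrite -(rep_ofK x) pg_mulE cats0. Qed.

Fact pg_mulV : left_inverse pg_one pg_inv pg_mul.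
Proof.
move=> x; rewrite -{2}(rep_ofK x) pg_mulE.
by apply/class_ofP; exact: weq_winvl.
Qed.

Fact pg_mulVr : right_inverse pg_one pg_inv pg_mul.
Proof.
move=> x; rewrite -{1}(rep_ofK x) pg_mulE.
by apply/class_ofP; exact: weq_winvr.
Qed.

HB.instance Definition _ :=
  isGroup.Build path_group pg_mulA pg_mul1 pg_mulr1 pg_mulV pg_mulVr.

Definition pg_vert (v : vert X) (g : vgrp v) : path_group :=
  class_of [:: lvert g].
Definition pg_edge (e : edge X) : path_group := class_of [:: ledge e].

Lemma pg_vertM v (g h : vgrp v) : pg_vert (g * h) = pg_vert g * pg_vert h.
Proof. by symmetry; rewrite [LHS]pg_mulE; apply/class_ofP; exact: weq_mul. Qed.

Lemma pg_vert1 v : pg_vert (1 : vgrp v) = 1.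
Proof. by apply/class_ofP; exact: weq_one. Qed.

Lemma pg_vertV v (g : vgrp v) : pg_vert g^-1 = (pg_vert g)^-1.
Proof. by apply: (mulgI (pg_vert g)); rewrite -pg_vertM !mulgV pg_vert1. Qed.

Lemma pg_edgeV e : pg_edge (einv e) = (pg_edge e)^-1.
Proof.
apply: (mulgI (pg_edge e)); rewrite mulgV [LHS]pg_mulE.
by apply/class_ofP; exact: weq_einv.
Qed.

Lemma pg_conj e (g : egrp e) :
  pg_edge e * pg_vert (emb g) * (pg_edge e)^-1 = pg_vert (emb (egrp_cast g)).
Proof.
rewrite -pg_edgeV.
transitivity (class_of ([:: ledge e] ++ [:: lvert (emb g)]
                         ++ [:: ledge (einv e)])).
  by rewrite -mulgA -2!pg_mulE.
by apply/class_ofP; exact: weq_conj.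
Qed.

(* [pg_path a b] is the set of classes of the words g_0 e_1 g_1 ... e_n g_n
   carried by the edge paths e_1, ..., e_n from a to b. *)
Inductive pg_path (a : vert X) : vert X -> path_group -> Prop :=
| pg_path_nil (g : vgrp a) : pg_path a a (pg_vert g)
| pg_path_rcons (e : edge X) (g : vgrp (tgt e)) (x : path_group) :
    pg_path a (src e) x -> pg_path a (tgt e) (x * pg_edge e * pg_vert g).

Lemma pg_path1 a : pg_path a a 1.
Proof. by rewrite -(pg_vert1 a); exact: pg_path_nil. Qed.

Lemma pg_path_vert a b x (g : vgrp b) :
  pg_path a b x -> pg_path a b (x * pg_vert g).
Proof.
move=> p; case: b x / p g => [h|e h y pay] g; first by rewrite -pg_vertM; exact: pg_path_nil.
by rewrite -mulgA -pg_vertM; exact: pg_path_rcons.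
Qed.

Lemma pg_path_edge a e x :
  pg_path a (src e) x -> pg_path a (tgt e) (x * pg_edge e).
Proof.
by move=> /(@pg_path_rcons a e 1); rewrite pg_vert1 mulg1.
Qed.

Lemma pg_pathM a b c x y :
  pg_path a b x -> pg_path b c y -> pg_path a c (x * y).
Proof.
move=> pabx; elim=> [g|e g z _ IH]; first exact: pg_path_vert.
by rewrite 2!mulgA; exact: pg_path_rcons.
Qed.

Lemma pg_pathV a b x : pg_path a b x -> pg_path b a x^-1.
Proof.
elim=> [g|e g y _ IH]; first by rewrite -pg_vertV; exact: pg_path_nil.
rewrite !invMg -pg_vertV -pg_edgeV mulgA; apply: pg_pathM IH.
have /pg_path_edge : pg_path (tgt e) (src (einv e)) (pg_vert g^-1).
  by rewrite src_einv; exact: pg_path_nil.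
by rewrite -(src_einv (einv e)) einvK.
Qed.

Definition pi1_pred (v0 : vert X) : {pred path_group} :=
  fun x => `[< pg_path v0 v0 x >].

Fact pi1_closed v0 : group_closed (pi1_pred v0).
Proof.
split; first by apply/asboolP; exact: pg_path1.
move=> x y /asboolP px /asboolP py; apply/asboolP.
by apply: pg_pathM px _; exact: pg_pathV.
Qed.

End PathGroup.

Definition pi1 (X : graph_of_groups) (v0 : vert X) : Type :=
  {x : path_group X | x \in pi1_pred v0}.
HB.instance Definition _ X v0 := SubChoice.on (@pi1 X v0).
HB.instance Definition _ X v0 :=
  SubChoice_isSubGroup.Build (path_group X) (pi1_pred v0) (@pi1 X v0)
    (@pi1_closed X v0).

Lemma pi1P (X : graph_of_groups) (v0 : vert X) (g : pi1 v0) :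
  pg_path v0 v0 (val g).
Proof. by apply/asboolP; exact: (valP g). Qed.

(* The Bass-Serre tree based at v0. Write P(v) for the set of path classes from
   v0 to v. A vertex over v is a coset x G_v with x in P(v); an edge over e is a
   coset C = x (image of G_e in G_(s e)) with x in P(s e). It goes from C G_(s e)
   to C e G_(t e), and its inverse is C e, an edge over einv e. *)
Section Tree.
Variables (X : graph_of_groups) (v0 : vert X).
Implicit Types (C : set (path_group X)).

Definition smul C D : set (path_group X) := [set x * y | x in C & y in D].

Definition vsub (v : vert X) : set (path_group X) := range (@pg_vert X v).

Definition esub (e : edge X) : set (path_group X) :=
  range (fun g : egrp e => pg_vert (emb (egrp_cast g))).

Definition is_tvert (u : vert X * set (path_group X)) : Prop :=
  exists2 x, pg_path v0 u.1 x & u.2 = smul [set x] (vsub u.1).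
Definition is_tedge (u : edge X * set (path_group X)) : Prop :=
  exists2 x, pg_path v0 (src u.1) x & u.2 = smul [set x] (esub u.1).

Definition tvert : Type := {u | is_tvert u}.
Definition tedge : Type := {u | is_tedge u}.

Lemma smulA : associative smul.
Proof.
move=> A B C; apply/seteqP; split=> z /=.
  move=> [x Ax [_ [y By [w Cw <-]] <-]].
  by exists (x * y); [exists x => //; exists y | exists w => //; rewrite mulgA].
move=> [_ [x Ax [y By <-]] [w Cw <-]].
by exists x => //; exists (y * w); [exists y => //; exists w | rewrite mulgA].
Qed.

Lemma smul11 x y : smul [set x] [set y] = [set x * y].
Proof.
apply/seteqP; split=> z /=; first by move=> [_ -> [_ -> <-]].
by move=> ->; exists x => //; exists y.
Qed.

Lemma smul1s C : smul [set 1] C = C.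
Proof.
apply/seteqP; split=> z /=; first by move=> [_ -> [y Cy <-]]; rewrite mul1g.
by move=> Cz; exists 1 => //; exists z => //; rewrite mul1g.
Qed.

Lemma smuls1 C : smul C [set 1] = C.
Proof.
apply/seteqP; split=> z /=; first by move=> [y Cy [_ -> <-]]; rewrite mulg1.
by move=> Cz; exists z => //; exists 1 => //; rewrite mulg1.
Qed.

Lemma egrp_cast_surj (e : edge X) (h : egrp (einv e)) :
  exists g : egrp e, egrp_cast g = h.
Proof.
rewrite /egrp_cast; move: h (egrp_einv e).
move: (egrp (einv e)) (egrp e) => A B h AB.
by move: h; case: B / AB => h; exists h.
Qed.

Lemma esub_emb (e : edge X) :
  esub e = range (fun g : egrp (einv e) => pg_vert (emb g)).
Proof.
apply/seteqP; split=> _ [g _ <-]; first by exists (egrp_cast g).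
by have [h <-] := egrp_cast_surj g; exists h.
Qed.

Lemma esub_einv (e : edge X) :
  esub (einv e) = range (fun g : egrp e => pg_vert (emb g)).
Proof. by rewrite esub_emb einvK. Qed.

Lemma esub_edge (e : edge X) :
  smul (esub e) [set pg_edge e] = smul [set pg_edge e] (esub (einv e)).
Proof.
rewrite esub_einv; apply/seteqP; split=> z /=.
  move=> [_ [g _ <-] [y -> <-]]; exists (pg_edge e) => //.
  exists (pg_vert (emb g)); first by exists g.
  by rewrite -pg_conj -mulgA mulVg mulg1.
move=> [y -> [_ [g _ <-] <-]]; exists (pg_vert (emb (egrp_cast g))).
  by exists g.
by exists (pg_edge e) => //; rewrite -pg_conj -mulgA mulVg mulg1.
Qed.

Lemma smul_vsub v (A : set (vgrp v)) :
  A 1 -> smul [set pg_vert g | g in A] (vsub v) = vsub v.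
Proof.
move=> A1; apply/seteqP; split=> z /=.
  by move=> [_ [g _ <-] [_ [h _ <-] <-]]; exists (g * h); rewrite ?pg_vertM.
move=> [g _ <-]; exists 1; first by exists 1; rewrite ?pg_vert1.
by exists (pg_vert g); [exists g|rewrite mul1g].
Qed.

Lemma emb1 (e : edge X) : emb (1 : egrp e) = 1.
Proof. by apply: (mulgI (emb 1)); rewrite -embM !mulg1. Qed.

Lemma esub_einv_vsub (e : edge X) :
  smul (esub (einv e)) (vsub (tgt e)) = vsub (tgt e).
Proof.
rewrite esub_einv.
have -> : range (fun g : egrp e => pg_vert (emb g)) =
          [set pg_vert g | g in range (@emb X e)].
  apply/seteqP; split=> z [g].
    by move=> _ <-; exists (emb g) => //; exists g.
  by move=> [h _ <-] <-; exists h.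
by apply: smul_vsub; exists 1 => //; exact: emb1.
Qed.

Lemma esub_vsub (e : edge X) : smul (esub e) (vsub (src e)) = vsub (src e).
Proof. by have := esub_einv_vsub (einv e); rewrite einvK -src_einv einvK. Qed.

Fact tsrc_subproof (u : tedge) :
  is_tvert (src (sval u).1, smul (sval u).2 (vsub (src (sval u).1))).
Proof.
case: u => -[e C] [x px /= ->]; exists x => //=.
by rewrite -smulA esub_vsub.
Qed.

Fact ttgt_subproof (u : tedge) :
  is_tvert (tgt (sval u).1,
    smul (smul (sval u).2 [set pg_edge (sval u).1]) (vsub (tgt (sval u).1))).
Proof.
case: u => -[e C] [x px /= ->]; exists (x * pg_edge e) => /=.
  exact: pg_path_edge.
by rewrite -(smulA [set x]) esub_edge smulA smul11 -smulA esub_einv_vsub.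
Qed.

Fact teinv_subproof (u : tedge) :
  is_tedge (einv (sval u).1, smul (sval u).2 [set pg_edge (sval u).1]).
Proof.
case: u => -[e C] [x px /= ->]; exists (x * pg_edge e) => /=.
  by rewrite src_einv; exact: pg_path_edge.
by rewrite -smulA esub_edge smulA smul11.
Qed.

Definition tsrc (u : tedge) : tvert := exist _ _ (tsrc_subproof u).
Definition ttgt (u : tedge) : tvert := exist _ _ (ttgt_subproof u).
Definition teinv (u : tedge) : tedge := exist _ _ (teinv_subproof u).

Fact teinvK : involutive teinv.
Proof.
move=> [[e C] h]; apply: eq_exist => /=.
by rewrite -smulA smul11 pg_edgeV mulgV smuls1 einvK.
Qed.

Fact teinv_neq u : teinv u <> u.
Proof. by move=> /(congr1 (fun u => (sval u).1)); exact: einv_neq. Qed.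

Fact tsrc_teinv u : tsrc (teinv u) = ttgt u.
Proof. by apply: eq_exist => /=; rewrite src_einv. Qed.

Definition bass_serre_tree : graph := Graph teinvK teinv_neq tsrc_teinv.

Fact tact_subproof (g : pi1 v0) (u : tvert) :
  is_tvert ((sval u).1, smul [set val g] (sval u).2).
Proof.
case: u => -[v C] [x px /= ->]; exists (val g * x) => /=.
  by apply: pg_pathM px; exact: pi1P.
by rewrite smulA smul11.
Qed.

Definition tree_act (g : pi1 v0) (u : vert bass_serre_tree) :
  vert bass_serre_tree := exist _ _ (tact_subproof g u).

End Tree.

Section Counting.
Variables (X : graph_of_groups) (v0 : vert X).
Local Notation Gamma := (pi1 v0).
Local Notation T := (bass_serre_tree v0).
Implicit Types g h : Gamma.

Definition hyperbolic g : Prop := forall u : vert T, tree_act g u <> u.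

Definition translation_length g : nat :=
  least (range (fun u : vert T => dist u (tree_act g u))).

Definition axis g : set (vert T) :=
  [set u | dist u (tree_act g u) = translation_length g].

Definition axis_stab g : set Gamma :=
  [set h | forall u, axis g u -> tree_act h u = u].

Definition cent_axis_stab g : set Gamma :=
  [set h | axis_stab g h /\ h * g = g * h].

Definition primitive g : Prop := forall h r, (1 < r)%N -> g <> h ^+ r.

(* The length of the primitive hyperbolic element underlying g. When vertex
   groups are nontrivial that element need not be unique; the minimum makes the
   value depend only on the conjugacy class of g. *)
Definition primitive_length g : nat :=
  least [set translation_length h | h in
    [set h | [/\ hyperbolic h, primitive h &
                 exists2 r, (0 < r)%N & g = h ^+ r]]].

Definition conj_class g : set Gamma := range (fun h => h^-1 * g * h).

Definition hyperbolic_classes (m : nat) : set (set Gamma) :=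
  [set conj_class g | g in
    [set g | hyperbolic g /\ translation_length g = m]].

(* The summand depends only on the class c, whose members it is evaluated at.
   The sum is extended-real valued since there may be infinitely many classes. *)
Definition N (R : realType) (m : nat) : \bar R :=
  (\esum_(c in hyperbolic_classes m)
    let g := xget 1%g c in
    ((primitive_length g)%:R / #|` fset_set (cent_axis_stab g)|%:R)%R%:E)%R.

End Counting.

Definition regular (d : nat) (X : graph_of_groups) (v0 : vert X) : Prop :=
  regular_graph (bass_serre_tree v0) d.

(* Main.v *)
(* When all the groups are trivial, N_m counts the cyclically reduced closed
   walks of length m in X, with base point: the classes of the free group pi_1
   are the cyclically reduced cyclic words, and the length of the underlying
   primitive element is the number of distinct rotations of the word. This count
   is the trace of B^m for the non-backtracking edge matrix B, and as in the
   Ihara-Bass formula, for a (q+1)-regular graph it equals, up to a bounded term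
   of period 2 in m, the sum of a^m + b^m over the eigenvalues a + b of the
   adjacency matrix, where a b = q. The eigenvalue q + 1 gives q^m + 1, and if the
   graph is connected and not bipartite every other root has modulus < q. On a
   long Mobius ladder with 4(k+1) vertices, two edges along the cycle and q - 1
   parallel edges between antipodes at each vertex, some other eigenvalue is close
   to q + 1, hence some root rho is close to q; for even m the remaining
   eigenvalues contribute at least -2 q^(m/2), so N_m - q^m is about rho^m or
   more. *)

Require Import Defs.
From mathcomp Require Import all_boot all_order all_algebra all_fingroup.
From mathcomp Require Import finmap complex.
From mathcomp Require Import all_classical all_reals all_analysis.
From mathcomp Require Import ring lra zify.

Set Implicit Arguments.
Unset Strict Implicit.
Unset Printing Implicit Defensive.

Local Notation cycle := path.cycle.
Local Notation order := fingraph.order.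

(** * Reduced words and rotations *)

Section FreeReduction.
Variables (E : eqType) (inv : E -> E).
Hypothesis invK : involutive inv.
Implicit Types (e f : E) (p r : seq E).

Definition nonback : rel E := fun e f => f != inv e.

(** Left multiplication by the letter [e] on reduced words, where at most one cancellation occurs,
    at the head. *)
Definition push e p := if p is f :: p' then if f == inv e then p' else e :: p
                       else [:: e].

Definition reduce p := foldr push [::] p.

Definition reduced p := sorted nonback p.

Lemma nonback_inv e f : nonback (inv f) (inv e) = nonback e f.
Proof. by rewrite /nonback invK eq_sym. Qed.

Lemma push_reduced e p : reduced p -> reduced (push e p).
Proof.
case: p => //= f p pf; case: eqVneq => [_|nef]; first exact: path_sorted pf.
by rewrite /= pf andbT.
Qed.

Lemma push_nonback e p : reduced (e :: p) -> push e p = e :: p.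
Proof. by case: p => //= f p /andP[/negPf ->]. Qed.

(** If [push e] has cancelled a head [inv e], putting it back must not cancel again, which
    reducedness of [p] ensures. Thus letters permute the reduced words. *)
Lemma pushK e p : reduced p -> push (inv e) (push e p) = p.
Proof.
case: p => [|f p] /=; first by rewrite invK eqxx.
case: eqVneq => [->|_]; first exact: push_nonback.
by rewrite /= invK eqxx.
Qed.

Lemma pushKV e p : reduced p -> push e (push (inv e) p) = p.
Proof. by rewrite -{1}(invK e); exact: pushK. Qed.

Lemma size_push e p : size (push e p) <= (size p).+1.
Proof. by case: p => //= f p; case: ifP => // _; rewrite leqW. Qed.

Lemma size_reduce p : size (reduce p) <= size p.
Proof. by elim: p => //= e p IH; exact: leq_trans (size_push _ _) _. Qed.

Lemma reduce_id p : reduced p -> reduce p = p.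
Proof.
elim: p => // e p IH pp; rewrite [LHS]/= IH ?push_nonback //.
exact: path_sorted pp.
Qed.

Definition rinv p := rev (map inv p).

Lemma rinv_cons e p : rinv (e :: p) = rcons (rinv p) (inv e).
Proof. by rewrite /rinv /= rev_cons. Qed.

Lemma rinv_reduced p : reduced p -> reduced (rinv p).
Proof.
move=> pp; rewrite /reduced /rinv rev_sorted sorted_map.
by under eq_sorted => e f do rewrite /= nonback_inv.
Qed.

Lemma cycle_reduced p : cycle nonback p -> reduced p.
Proof. by case: p => //= e p; rewrite rcons_path => /andP[]. Qed.

Lemma cycle_nonback_flatten n p :
  cycle nonback p -> cycle nonback (flatten (nseq n p)).
Proof.
case: n => // n; case: p => [|e p].
  by rewrite (_ : flatten _ = [::]) //; elim: n.
rewrite /= rcons_path => /andP[pp bp].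
elim: n => [|n]; rewrite /= ?cats0 !rcons_path ?pp //= => /andP[pf bf].
by rewrite cat_path last_cat pp /= bp pf.
Qed.

End FreeReduction.

Lemma iter_order_dvdn (T : finType) (f : T -> T) (x : T) (k : nat) :
  injective f -> iter k f x = x -> order f x %| k.
Proof.
move=> injf; rewrite {1}(divn_eq k (order f x)) addnC iterD.
have -> : iter (k %/ order f x * order f x) f x = x.
  by elim: (k %/ _) => // n IH; rewrite mulSn iterD IH iter_order.
have lt_k : k %% order f x < order f x by rewrite ltn_mod fingraph.order_gt0.
move=> eqx; rewrite /dvdn -(findex_iter lt_k) eqx; apply/eqP; exact: findex0.
Qed.

(** * Powers and periods of words *)

Section Powers.
Variable E : eqType.
Implicit Types u v w t : seq E.

Definition pow u n := flatten (nseq n u).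

Lemma powD u m n : pow u (m + n) = pow u m ++ pow u n.
Proof. by rewrite /pow nseqD flatten_cat. Qed.

Lemma pow1 u : pow u 1 = u.
Proof. exact: cats0. Qed.

Lemma size_pow u n : size (pow u n) = n * size u.
Proof. by rewrite size_flatten /shape map_nseq sumn_nseq mulnC. Qed.

Lemma rot_pow u n : rot (size u) (pow u n) = pow u n.
Proof.
case: n => // n; rewrite -add1n powD pow1 rot_size_cat.
by rewrite -[X in _ ++ X = _]pow1 -powD addnC powD pow1.
Qed.

(** Comparing prefixes shows that [w] starts with [v], and what remains of [w] still commutes with
    [v], so copies of [v] can be peeled off. *)
Lemma cat_comm_pow v w k :
  size w = k * size v -> v ++ w = w ++ v -> w = pow v k.
Proof.
elim: k w => [|k IH] w; first by move/size0nil.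
rewrite mulSn => sw eqvw.
have : take (size v) (v ++ w) = take (size v) (w ++ v) by rewrite eqvw.
rewrite take_size_cat // takel_cat ?sw ?leq_addr // => eqv.
move: eqvw sw; rewrite -(cat_take_drop (size v) w) -eqv -catA => /eqP.
rewrite eqseq_cat // eqxx /= => /eqP eqvw; rewrite size_cat => /addnI sw.
by rewrite [LHS](congr1 (cat v) (IH _ sw eqvw)) /pow.
Qed.

(** Invariance under [rot d] says that [take d t] commutes with [t]. *)
Lemma rot_fix_pow t d : d %| size t -> rot d t = t ->
  t = pow (take d t) (size t %/ d).
Proof.
case: (posnP (size t)) => [/size0nil ->|t_gt0 dvd_d fixt]; first by rewrite div0n.
have d_le := dvdn_leq t_gt0 dvd_d.
have d_gt0 := dvdn_gt0 t_gt0 dvd_d.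
have sv : size (take d t) = d by rewrite size_takel.
apply: cat_comm_pow; first by rewrite sv divnK.
by rewrite -[X in _ = X ++ _](cat_take_drop d) -catA -/(rot d t) fixt.
Qed.

(** The power of [u] is a power of its prefix of length [d]; since [d] divides [size u], cutting
    after the first copy of [u] shows the same for [u]. *)
Lemma pow_root u n d : 0 < n -> d %| size u -> rot d (pow u n) = pow u n ->
  u = pow (take d u) (size u %/ d).
Proof.
move=> n_gt0 dvd_d fixu.
have dvd_d' : d %| size (pow u n) by rewrite size_pow dvdn_mull.
have := rot_fix_pow dvd_d' fixu.
case: (posnP (size u)) => [/size0nil -> _|u_gt0]; first by rewrite div0n.
have d_le := dvdn_leq u_gt0 dvd_d.
have d_gt0 := dvdn_gt0 u_gt0 dvd_d.
rewrite size_pow -muln_divA // -[n](prednK n_gt0) mulSn powD.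
rewrite -(prednK n_gt0) -add1n (powD u) pow1 takel_cat //.
set v := take d u => /eqP.
have sv : size v = d by rewrite size_takel.
by rewrite eqseq_cat ?size_pow ?sv ?divnK // => /andP[/eqP].
Qed.

End Powers.

(** * Rotation orbits of tuples *)

Section Rotation.
Variables (E : finType) (m : nat).
Implicit Type t : m.-tuple E.

Definition rot1 t : m.-tuple E := [tuple of rot 1 t].

Lemma rot1_inj : injective rot1.
Proof. by move=> t u /(congr1 val) /= /rot_inj /val_inj. Qed.

Lemma val_iter_rot1 t k : k <= m -> val (iter k rot1 t) = rot k t.
Proof.
elim: k => [|k IH] km; first by rewrite rot0.
rewrite iterS /= (IH (ltnW km)) -rotD ?size_tuple //.
Qed.

Lemma fconnect_rot1P t t' :
  reflect (exists2 k, k <= m & val t' = rot k t) (fconnect rot1 t t').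
Proof.
apply: (iffP idP) => [ct|[k km /= eqt]].
  case: (posnP m) => [m0|m_gt0].
    exists 0 => //; rewrite rot0; move: t t' {ct}; rewrite m0 => t t'.
    by rewrite (tuple0 t) (tuple0 t').
  have iterm : iter m rot1 t = t.
    by apply: val_inj; rewrite val_iter_rot1 // -{1}(size_tuple t) rot_size.
  exists (findex rot1 t t'); last rewrite -val_iter_rot1 ?iter_findex //.
    apply: leq_trans (ltnW (findex_max ct)) _.
    exact: dvdn_leq (iter_order_dvdn rot1_inj iterm).
  apply: leq_trans (ltnW (findex_max ct)) _.
  exact: dvdn_leq (iter_order_dvdn rot1_inj iterm).
have -> : t' = iter k rot1 t by apply: val_inj; rewrite val_iter_rot1.
exact: fconnect_iter.
Qed.

Lemma order_rot1_dvdn t k : k <= m -> rot k t = t -> order rot1 t %| k.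
Proof.
move=> km eqt; apply: iter_order_dvdn; first exact: rot1_inj.
by apply: val_inj; rewrite val_iter_rot1.
Qed.

Lemma order_rot1_dvdn_size t : order rot1 t %| m.
Proof.
by apply: order_rot1_dvdn; rewrite // -{1}(size_tuple t) rot_size.
Qed.

Lemma rot_order_rot1 t : 0 < m -> rot (order rot1 t) t = t.
Proof.
move=> m_gt0; rewrite -val_iter_rot1.
  by rewrite iter_order //; exact: rot1_inj.
exact: dvdn_leq (order_rot1_dvdn_size t).
Qed.

End Rotation.

(** * Graphs of trivial groups *)

Local Open Scope classical_set_scope.
Local Open Scope card_scope.
Local Open Scope group_scope.

Record fin_graph := FinGraph {
  fin_vert : finType;
  fin_edge : finType;
  fin_src : fin_edge -> fin_vert;
  fin_tgt : fin_edge -> fin_vert;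
  fin_inv : fin_edge -> fin_edge;
  fin_invK : involutive fin_inv;
  fin_inv_neq : forall e, fin_inv e <> e;
  fin_src_inv : forall e, fin_src (fin_inv e) = fin_tgt e
}.

(** The non-backtracking edge relation. Its cycles are the closed walks that are reduced also across
    the base point. *)
Definition step (G : fin_graph) : rel (fin_edge G) :=
  fun e f => (fin_tgt e == fin_src f) && nonback (@fin_inv G) e f.

Definition graph_of_fin (G : fin_graph) : graph :=
  Graph (@fin_invK G) (@fin_inv_neq G) (@fin_src_inv G).

Definition trivial_groups (G : fin_graph) : graph_of_groups :=
  @GraphOfGroups (graph_of_fin G) (fun=> 'I_1) (fun=> 'I_1) (fun=> erefl)
    (fun _ => id) (fun _ _ _ => erefl) (fun _ => @inj_id _).

(** * Reduced edge sequences as normal forms in the path group *)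

Section PathGroup.
Variable G : fin_graph.
Local Notation E := (fin_edge G).
Local Notation V := (fin_vert G).
Local Notation inv := (@fin_inv G).
Local Notation X := (trivial_groups G).
Local Notation push := (push inv).
Local Notation reduce := (reduce inv).
Local Notation reduced := (reduced inv).
Local Notation rinv := (rinv inv).
Implicit Types (e f : E) (p r : seq E) (a b : V) (x y z : path_group X).

Local Notation invK := (@fin_invK G).

Lemma pg_vert_trivial (v : V) (g : vgrp (v : vert X)) : pg_vert g = 1.
Proof.
have -> : g = 1 by exact: etrans (ord1 (g : 'I_1)) (esym (ord1 (1 : 'I_1))).
exact: pg_vert1.
Qed.

Definition pg_edges p : path_group X := class_of (map (@ledge X) p).

Lemma pg_edges0 : pg_edges [::] = 1.
Proof. by []. Qed.

Lemma pg_edges_cat p r : pg_edges (p ++ r) = pg_edges p * pg_edges r.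
Proof. by rewrite /pg_edges map_cat -pg_mulE. Qed.

Lemma pg_edges_cons e p : pg_edges (e :: p) = pg_edge (e : edge X) * pg_edges p.
Proof. by rewrite -cat1s pg_edges_cat. Qed.

Lemma pg_edgesV p : pg_edges (rinv p) = (pg_edges p)^-1.
Proof.
elim: p => [|e p IH]; first by rewrite pg_edges0 invg1.
rewrite rinv_cons -cats1 pg_edges_cat IH pg_edges_cons invMg; congr (_ * _).
exact: (@pg_edgeV X e).
Qed.

(** Words act on edge sequences, vertex letters trivially and edges by [push]. Applied to the empty
    sequence this yields a normal form without any confluence argument. *)
Definition act (w : word X) p : seq E :=
  foldr (fun l => match l with inl _ => id | inr e => push e end) p w.

Lemma act_cat w1 w2 p : act (w1 ++ w2) p = act w1 (act w2 p).
Proof. exact: foldr_cat. Qed.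

Lemma act_reduced w p : reduced p -> reduced (act w p).
Proof. by move=> pp; elim: w => //= -[u|e] w //=; exact: push_reduced. Qed.

(** Each defining relation acts trivially on reduced sequences; for the two relations that involve
    edges this is [pushKV]. *)
Lemma act_weq w1 w2 : weq w1 w2 ->
  forall p, reduced p -> act w1 p = act w2 p.
Proof.
elim=> {w1 w2} [//|w1 w2 _ IH p pp|w1 w2 w3 _ IH1 _ IH2 p pp
  |w1 w2 w1' w2' _ IH1 _ IH2 p pp|//|//|e p pp|e g p pp].
- by rewrite IH.
- by rewrite IH1 ?IH2.
- by rewrite !act_cat IH2 // IH1 //; exact: act_reduced.
- exact: (pushKV invK e pp).
- exact: (pushKV invK e pp).
Qed.

Lemma pg_edges_push e p : pg_edges (push e p) = pg_edge (e : edge X) * pg_edges p.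
Proof.
case: p => [|f p] //=; first by rewrite pg_edges_cons.
case: eqVneq => [->|_]; last by rewrite pg_edges_cons.
by rewrite pg_edges_cons (@pg_edgeV X e) mulKVg.
Qed.

Lemma class_of_act (w : word X) p : class_of w * pg_edges p = pg_edges (act w p).
Proof.
elim: w => [|l w IH]; first by rewrite mul1g.
have -> : class_of (l :: w) = class_of [:: l] * class_of w.
  by rewrite [RHS]pg_mulE.
rewrite -mulgA IH; case: l => [[v g]|e] /=; last by rewrite pg_edges_push.
rewrite -[RHS]mul1g; congr (_ * _); exact: pg_vert_trivial.
Qed.

(** The unique reduced edge sequence that represents [x]; it does not depend on the representative
    word by [act_weq]. *)
Definition nf x := act (rep_of x) [::].

Lemma pg_edgesK x : pg_edges (nf x) = x.
Proof. by rewrite -class_of_act rep_ofK mulg1. Qed.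

Lemma nf_reduced x : reduced (nf x).
Proof. exact: act_reduced. Qed.

Lemma nf_pg_edges p : nf (pg_edges p) = reduce p.
Proof.
rewrite /nf (act_weq (rep_class _)) //.
by elim: p => //= e p ->.
Qed.

Lemma nf_pg_edges_id p : reduced p -> nf (pg_edges p) = p.
Proof. by move=> pp; rewrite nf_pg_edges reduce_id. Qed.

Lemma size_nf_pg_edges p : size (nf (pg_edges p)) <= size p.
Proof. by rewrite nf_pg_edges size_reduce. Qed.

Lemma pg_edges_inj p r : reduced p -> reduced r -> pg_edges p = pg_edges r -> p = r.
Proof. by move=> pp rr /(congr1 nf); rewrite !nf_pg_edges_id. Qed.

Lemma nf1 : nf 1 = [::].
Proof. exact: (@nf_pg_edges_id [::]). Qed.

Lemma nf_eq0 x : (size (nf x) == 0%N) = (x == 1).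
Proof.
apply/eqP/eqP => [/size0nil nf0|->]; last by rewrite nf1.
by rewrite -(pg_edgesK x) nf0.
Qed.

Lemma size_nfM x y : size (nf (x * y)) <= size (nf x) + size (nf y).
Proof.
rewrite -{1}(pg_edgesK x) -{1}(pg_edgesK y) -pg_edges_cat -size_cat.
exact: size_nf_pg_edges.
Qed.

Lemma size_nfX x n : size (nf (x ^+ n)) <= n * size (nf x).
Proof.
elim: n => [|n IH]; first by rewrite expg0 nf1.
by rewrite expgS mulSn; apply: leq_trans (size_nfM _ _) _; rewrite leq_add2l.
Qed.

Lemma size_nfV x : size (nf x^-1) = size (nf x).
Proof.
rewrite -{1}(pg_edgesK x) -pg_edgesV nf_pg_edges_id.
  by rewrite size_rev size_map.
by apply: rinv_reduced; [exact: invK|exact: nf_reduced].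
Qed.

Lemma pg_edges_pow p n : pg_edges (pow p n) = pg_edges p ^+ n.
Proof. by elim: n => //= n IH; rewrite expgS -IH -pg_edges_cat. Qed.

Lemma walk_cat a p r b :
  @is_walk X a (p ++ r) b <-> exists2 c, @is_walk X a p c & @is_walk X c r b.
Proof.
elim: p a => [|e p IH] a /=; first by split=> [?|[_ ->]] //; exists a.
split=> [[<- /IH[c pc cr]]|[c [<- pc] cr]]; first by exists c.
by split=> //; apply/IH; exists c.
Qed.

Lemma walk_push e p b : @is_walk X (fin_tgt e) p b ->
  @is_walk X (fin_src e) (push e p) b.
Proof.
case: p => [|f p] //= [sf pf]; case: eqVneq => [ef|_]; last by [].
by rewrite ef -fin_src_inv fin_invK in pf.
Qed.

Lemma walk_reduce a p b : @is_walk X a p b -> @is_walk X a (reduce p) b.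
Proof. by elim: p a => //= e p IH a [<- /IH]; exact: walk_push. Qed.

Lemma walk_pg_path a p b : @is_walk X a p b -> @pg_path X a b (pg_edges p).
Proof.
elim: p a => [|e p IH] a /=; first by move=> ->; exact: pg_path1.
case=> <- /IH pp; rewrite pg_edges_cons; apply: pg_pathM pp.
rewrite -[pg_edge _]mul1g; apply: (@pg_path_edge X _ e); exact: pg_path1.
Qed.

(** Dropping the vertex letters gives a walk that represents [x], and cancelling backtracks keeps
    its endpoints. *)
Lemma pg_path_walk a b x : @pg_path X a b x -> @is_walk X a (nf x) b.
Proof.
move=> px; have [p pp ->] : exists2 p, @is_walk X a p b & x = pg_edges p.
  elim: px => [g|e g y _ [p pp ->]].
    by exists [::] => //; rewrite pg_vert_trivial.
  exists (p ++ [:: e]); first by apply/walk_cat; exists (fin_src e).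
  by rewrite pg_vert_trivial mulg1 pg_edges_cat.
by rewrite nf_pg_edges; exact: walk_reduce.
Qed.

End PathGroup.

(** * Conjugacy and cyclic reduction *)

Section Conjugacy.
Variable G : fin_graph.
Local Notation E := (fin_edge G).
Local Notation V := (fin_vert G).
Local Notation inv := (@fin_inv G).
Local Notation X := (trivial_groups G).
Local Notation reduced := (reduced inv).
Local Notation rinv := (rinv inv).
Local Notation nonback := (nonback inv).
Implicit Types (e f : E) (p r : seq E) (a b : V) (x y z : path_group X).
Local Notation invK := (@fin_invK G).

Lemma rot_conj k p :
  pg_edges (rot k p) = (pg_edges (take k p))^-1 * pg_edges p * pg_edges (take k p).
Proof. by rewrite -{3}(cat_take_drop k p) !pg_edges_cat mulKg. Qed.

(** Induction on the conjugator [s]. If its first letter cancels against an end of [p], conjugating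
    by this letter is a rotation of [p] by one step, and [s] gets shorter. *)
Lemma conj_cyc_rot p r (s : seq E) : p != [::] -> cycle nonback p ->
  cycle nonback r -> reduced s ->
  (pg_edges s)^-1 * pg_edges p * pg_edges s = pg_edges r -> exists k, r = rot k p.
Proof.
move=> p0 cp cr; elim: s p p0 cp => [|e s IH] p p0 cp rs.
  rewrite pg_edges0 invg1 mul1g mulg1 => /pg_edges_inj -> //; try exact: cycle_reduced.
  by exists 0%N; rewrite rot0.
have rs' : reduced s by exact: path_sorted rs.
have rec k :
    (pg_edges [:: e])^-1 * pg_edges p * pg_edges [:: e] = pg_edges (rot k p) ->
    (pg_edges (e :: s))^-1 * pg_edges p * pg_edges (e :: s) = pg_edges r ->
    exists k, r = rot k p.
  move=> hk; have -> : (pg_edges (e :: s))^-1 * pg_edges p * pg_edges (e :: s) =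
      (pg_edges s)^-1 * ((pg_edges [:: e])^-1 * pg_edges p * pg_edges [:: e]) * pg_edges s.
    by rewrite -(cat1s e s) pg_edges_cat invMg !mulgA.
  rewrite hk => eqr.
  case: (IH (rot k p) _ _ rs' eqr) => [||j ->]; rewrite ?rot_cycle //.
    by rewrite -size_eq0 size_rot size_eq0.
  by exists (rot_add p k j); rewrite rot_rot_add.
case: p p0 cp {IH} rec => // f p _ cp rec.
case: (eqVneq f e) => [fe|nfe].
  by apply: (rec 1%N); rewrite rot1_cons -cats1 -(cat1s f p) !pg_edges_cat fe mulKg.
case: (eqVneq (last f p) (inv e)) => [le|nle].
  apply: (rec (size p)); rewrite (lastI f p) le -cats1 -(size_belast f).
  by rewrite rot_size_cat !pg_edges_cat (@pg_edgesV G [:: e]) -!mulgA mulVg mulg1.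
(* Nothing cancels at either end of [p], so the conjugate is reduced as written. It then equals [r],
   yet starts with the inverse of its last letter. *)
move=> eqr; exfalso.
have rr : reduced (rinv (e :: s) ++ (f :: p) ++ (e :: s)).
  have := rinv_reduced invK rs; have := cycle_reduced cp.
  have ne : nonback (last f p) e.
    by rewrite /nonback; apply: contraNneq nle => ->; rewrite invK.
  have nf : nonback (inv e) f by rewrite /nonback invK.
  move: rs; rewrite rinv_cons -cats1 -catA /reduced => rs.
  case: (rinv s) => [|g u] /= pp; rewrite ?cat_path /= ?cat_path /= ?andbT.
    by rewrite nf pp ne.
  by move=> /andP[-> ->]; rewrite /= nf pp ne.
have : r = rinv (e :: s) ++ (f :: p) ++ (e :: s).
  apply: (@pg_edges_inj G) => //; first exact: cycle_reduced.
  by rewrite -eqr !pg_edges_cat pg_edgesV mulgA.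
rewrite (lastI e s) /rinv map_rcons rev_rcons cat_cons catA -rcons_cat => er.
by move: cr; rewrite er /path.cycle rcons_path last_rcons /nonback eqxx andbF.
Qed.

(* Compare the lengths of y (y^-1 p y)^k y^-1 = p^k for k > 2 |y|. *)
Lemma size_conj p y : cycle nonback p ->
  size p <= size (nf (y^-1 * pg_edges p * y)).
Proof.
move=> cp; set h := _ * y; set k := (size (nf y)).*2.+1.
have eqk : pg_edges (pow p k) = y * h ^+ k * y^-1.
  rewrite pg_edges_pow; elim: (k) => [|j IH]; first by rewrite !expg0 mulg1 mulgV.
  by rewrite !expgS IH /h !mulgA mulgV mul1g.
have szk : size (nf (pg_edges (pow p k))) = (k * size p)%N.
  by rewrite nf_pg_edges_id ?size_pow //; exact/cycle_reduced/cycle_nonback_flatten.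
have := size_nfM (y * h ^+ k) y^-1.
rewrite -eqk szk size_nfV => le1.
have le2 := size_nfM y (h ^+ k).
have le3 := size_nfX h k.
rewrite leqNgt; apply/negP => lt.
have : (k * size (nf h) + k <= k * size p)%N by rewrite -mulnSr leq_mul.
by rewrite /k in le1 le2 le3 *; lia.
Qed.

(** Induction on the length: a reduced closed walk that is not cyclically reduced has the form e s
    e^-1, with [s] a shorter closed walk at the target of [e]. *)
Lemma closed_core a x : @pg_path X a a x -> x != 1 ->
  exists b y p, [/\ @pg_path X a b y, p != [::], @is_walk X b p b,
    cycle nonback p & x = y * pg_edges p * y^-1].
Proof.
move: {2}(size (nf x)).+1 (ltnSn (size (nf x))) => n.
elim: n a x => // n IH a x; rewrite ltnS => szx px x1.
have wx := pg_path_walk px; have rx := nf_reduced x.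
case: (boolP (cycle nonback (nf x))) => [cx|ncx].
  exists a, 1, (nf x); split => //; first exact: pg_path1.
    by rewrite -size_eq0 nf_eq0.
  by rewrite mul1g pg_edgesK invg1 mulg1.
have eqx := pg_edgesK x.
case: (nf x) szx rx wx ncx eqx => // e s szs rs [/= se ws].
rewrite rcons_path => nlast eqx.
have le : e = inv (last e s).
  by move: nlast; rewrite [path _ _ _]rs /= negbK => /eqP.
(* A single letter would be its own inverse. *)
case/lastP: s => [|s l] in szs rs ws {nlast} eqx le *.
  by case: (@fin_inv_neq G e).
rewrite last_rcons in le; rewrite -cats1 in ws szs.
have eqx' : x = pg_edges [:: e] * pg_edges s * (pg_edges [:: e])^-1.
  by rewrite -eqx -pg_edgesV -!pg_edges_cat /rinv /= le invK -cats1.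
have /walk_cat[c ws' [/= sl tl]] := ws.
have sc : c = fin_tgt e by rewrite -sl le -fin_src_inv invK.
rewrite {c}sc in ws' sl.
have pe : @pg_path X a (fin_tgt e) (pg_edges [:: e]) by apply: walk_pg_path.
case: (IH (fin_tgt e) (pg_edges s)) => [|||b [y [p [py p0 wp cp eqs]]]].
- apply: leq_ltn_trans (size_nf_pg_edges s) _.
  by move: szs; rewrite /= size_cat addn1 => /ltnW.
- exact: walk_pg_path.
- by apply: contraNneq x1 => s1; rewrite eqx' s1 mulg1 mulgV.
exists b, (pg_edges [:: e] * y), p; split=> //; first exact: pg_pathM pe py.
by rewrite eqx' eqs invMg !mulgA.
Qed.

End Conjugacy.

Lemma least_eq (A : set nat) n :
  A n -> (forall k, A k -> n <= k) -> least A = n.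
Proof.
move=> An ngeA; rewrite /least; case: xgetP => [m _ [Am mle]|/(_ n)[]//].
by apply/eqP; rewrite eqn_leq mle //= ngeA.
Qed.

(** * The Bass-Serre tree and the free action on it *)

Section Tree.
Variables (G : fin_graph) (v0 : fin_vert G).
Local Notation E := (fin_edge G).
Local Notation V := (fin_vert G).
Local Notation inv := (@fin_inv G).
Local Notation X := (trivial_groups G).
Local Notation T := (@bass_serre_tree X v0).
Local Notation Gamma := (@pi1 X v0).
Implicit Types (e f : E) (p r : seq E) (a b : V) (x y z : path_group X).
Implicit Types (u : vert T) (g h : Gamma).
Local Notation invK := (@fin_invK G).

Lemma vsub_trivial a : @vsub X a = [set 1].
Proof.
apply/seteqP; split=> z /=; first by move=> [g _ <-]; exact: pg_vert_trivial.
by move=> ->; exists 1 => //; exact: pg_vert_trivial.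
Qed.

Lemma esub_trivial e : @esub X e = [set 1].
Proof.
apply/seteqP; split=> z /=; first by move=> [g _ <-]; exact: pg_vert_trivial.
by move=> ->; exists 1 => //; exact: pg_vert_trivial.
Qed.

Lemma set1_inj (U : Type) : injective (@set1 U).
Proof. by move=> x y exy; have : [set y] x by rewrite -exy. Qed.

(** With trivial groups the coset is a singleton, so vertices of the tree are path classes starting
    at [v0]. *)
Definition tpoint a x (px : @pg_path X v0 a x) : vert T :=
  exist (@is_tvert X v0) (a, smul [set x] (@vsub X a))
    (ex_intro2 _ _ x px erefl).

Lemma tpointE a x (px : @pg_path X v0 a x) : sval (tpoint px) = (a, [set x]).
Proof. by rewrite /= vsub_trivial smuls1. Qed.

Lemma tpoint_surj u : exists a x (px : @pg_path X v0 a x), u = tpoint px.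
Proof.
by case: u => -[a C] [x /= px eC]; exists a, x, px; apply: eq_exist; rewrite /= eC.
Qed.

Lemma tpoint_inj a x px b y py :
  @tpoint a x px = @tpoint b y py <-> a = b /\ x = y.
Proof.
split=> [/(congr1 sval)|[ab xy]].
  by rewrite !tpointE => -[ab xy]; split=> //; exact: set1_inj xy.
by apply: eq_exist; rewrite /= ab xy.
Qed.

Definition tarc e x (px : @pg_path X v0 (fin_src e) x) : edge T :=
  exist (@is_tedge X v0) (e, smul [set x] (@esub X e))
    (ex_intro2 _ _ x px erefl).

Lemma tarc_surj (d : edge T) :
  exists e x (px : @pg_path X v0 (fin_src e) x), d = tarc px.
Proof.
by case: d => -[e C] [x /= px eC]; exists e, x, px; apply: eq_exist; rewrite /= eC.
Qed.

Lemma src_tarc e x px a y (py : @pg_path X v0 a y) :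
  src (@tarc e x px) = tpoint py <-> fin_src e = a /\ x = y.
Proof.
rewrite -(tpoint_inj px py).
suff -> : src (tarc px) = tpoint px by [].
apply: eq_exist => /=.
by rewrite (@esub_trivial e) (@vsub_trivial (fin_src e)) smuls1.
Qed.

Lemma tgt_tarc e x px (py : @pg_path X v0 (fin_tgt e) (x * pg_edges [:: e])) :
  tgt (@tarc e x px) = tpoint py.
Proof.
by apply: eq_exist => /=; rewrite (@esub_trivial e) smuls1 smul11.
Qed.

(** Walks lift to the tree once their starting point is chosen, and the lift of [p] from [x] ends at
    [x] times the class of [p]. *)
Lemma tree_walkP a x (px : @pg_path X v0 a x) b y (py : @pg_path X v0 b y) n :
  (exists2 w, is_walk (tpoint px) w (tpoint py) & size w = n) <->
  (exists p, [/\ @is_walk X a p b, y = x * pg_edges p & size p = n]).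
Proof.
elim: n a x px => [|n IH] a x px.
  split=> [[w ww /size0nil w0]|[p [wp ey /size0nil p0]]].
    rewrite w0 /= in ww; have [-> ->] := (tpoint_inj px py).1 ww.
    by exists [::]; rewrite pg_edges0 mulg1.
  exists [::] => //=; apply/tpoint_inj; rewrite p0 /= in wp ey.
  by rewrite ey pg_edges0 mulg1.
have pxe e : fin_src e = a -> @pg_path X v0 (fin_tgt e) (x * pg_edges [:: e]).
  by move=> ea; subst a; exact: (@pg_path_edge X _ e).
split=> [[w ww sw]|[p [wp ey sp]]].
  case: w sw ww => // d w /= [sw] [sd ww].
  have [e [x' [px' ed]]] := tarc_surj d; subst d.
  have [se ex] := (src_tarc px' px).1 sd; subst x'.
  have {}ww : is_walk (tpoint (pxe e se)) w (tpoint py).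
    by rewrite -(tgt_tarc px').
  have [p [wp -> sp]] := (IH _ _ (pxe e se)).1 (ex_intro2 _ _ w ww sw).
  by exists (e :: p); split=> //=; [rewrite -mulgA -pg_edges_cat|rewrite sp].
case: p sp wp ey => // e p /= [sp] [se wp] ey; subst a.
have [|w ww sw] := (IH _ _ (pxe e erefl)).2.
  by exists p; split=> //; rewrite ey -cat1s pg_edges_cat mulgA.
exists (tarc px :: w) => //=; last by rewrite sw.
split; first exact/src_tarc.
by move: ww; rewrite -(tgt_tarc px).
Qed.

(** All walks between the two points represent the same class, and the reduced one is the
    shortest. *)
Lemma dist_tpoint a x (px : @pg_path X v0 a x) b y (py : @pg_path X v0 b y) :
  dist (tpoint px) (tpoint py) = size (nf (x^-1 * y)).
Proof.
apply: least_eq => [|n [w ww sw]].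
  have wn : @is_walk X a (nf (x^-1 * y)) b.
    by apply: pg_path_walk; apply: pg_pathM py; exact: pg_pathV.
  have [|w ww sw] := (tree_walkP px py (size (nf (x^-1 * y)))).2; last by exists w.
  by exists (nf (x^-1 * y)); split=> //; rewrite pg_edgesK mulVKg.
have [|p [_ -> <-]] := (tree_walkP px py n).1; first by exists w.
by rewrite mulKg size_nf_pg_edges.
Qed.

Lemma pg_path_act g a x : @pg_path X v0 a x -> @pg_path X v0 a (val g * x).
Proof. by move=> px; apply: pg_pathM px; exact: pi1P. Qed.

Lemma tree_act_tpoint g a x (px : @pg_path X v0 a x) :
  tree_act g (tpoint px) = tpoint (pg_path_act g px).
Proof. by apply: eq_exist; rewrite /= smulA smul11. Qed.

(** The action is left multiplication on path classes, hence free. *)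
Lemma tree_act_fix g u : tree_act g u = u <-> g = 1.
Proof.
have [a [x [px ->]]] := tpoint_surj u; rewrite tree_act_tpoint tpoint_inj.
split=> [[_ gx]|->]; last by rewrite mul1g.
by apply: val_inj; apply: (mulIg x); rewrite gx mul1g.
Qed.

Lemma hyperbolicE g : hyperbolic g <-> g <> 1.
Proof.
split=> [hg g1|g1 u]; last by rewrite tree_act_fix.
by apply: (hg (tpoint (pg_path1 (X := X) v0))); rewrite tree_act_fix.
Qed.

Lemma dist_act g a x (px : @pg_path X v0 a x) :
  dist (tpoint px) (tree_act g (tpoint px)) = size (nf (x^-1 * val g * x)).
Proof. by rewrite tree_act_tpoint dist_tpoint mulgA. Qed.

(* The cyclically reduced closed walk p represents the free homotopy class of
   the element g. *)
Definition core g p : Prop := exists b x,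
  [/\ @pg_path X v0 b x, p != [::], @is_walk X b p b, cycle (nonback inv) p &
      val g = x * pg_edges p * x^-1].

Lemma core_exists g : g <> 1 -> exists p, core g p.
Proof.
move=> g1; have [||b [x [p cp]]] := @closed_core G v0 (val g).
- exact: pi1P.
- by apply/eqP => vg1; apply: g1; apply: val_inj.
by exists p, b, x.
Qed.

Lemma core_neq1 g p : core g p -> g <> 1.
Proof.
move=> [b [x [_ p0 _ cp eg]]] g1.
have e1 : x * pg_edges p * x^-1 = 1 by rewrite -eg g1.
have /pg_edges_inj e0 : pg_edges p = pg_edges [::].
  by apply: (mulgI x); apply: (mulIg x^-1); rewrite e1 pg_edges0 mulg1 mulgV.
by rewrite e0 // in p0; exact: cycle_reduced.
Qed.

(** The displacement is [size p] at the point [x] from which [p] is read, and at any other point it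
    is the length of a conjugate of [p], bounded below by [size_conj]. *)
Lemma core_translation g p : core g p ->
  translation_length g = size p.
Proof.
move=> [b [x [px p0 wp cp eg]]]; apply: least_eq.
  exists (tpoint px) => //; rewrite dist_act eg -!mulgA mulVg mulg1 mulKg.
  by rewrite nf_pg_edges_id //; exact: cycle_reduced.
move=> _ [u _ <-]; have [a [y [py ->]]] := tpoint_surj u.
rewrite dist_act eg (_ : _ * _ = (x^-1 * y)^-1 * pg_edges p * (x^-1 * y)).
  exact: size_conj.
by rewrite invMg invgK !mulgA.
Qed.

(** The core supplies a point of the axis, and only the identity fixes it. *)
Lemma cent_axis_stab_trivial g p : core g p -> cent_axis_stab g = [set 1].
Proof.
move=> cg; have tg := core_translation cg.
move: cg => [b [x [px p0 wp cp eg]]]; apply/seteqP; split=> h /=.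
  move=> [hg _]; have := hg (tpoint px); rewrite tree_act_fix; apply.
  rewrite /axis /= tg dist_act eg -!mulgA mulVg mulg1 mulKg.
  by rewrite nf_pg_edges_id //; exact: cycle_reduced.
move=> ->; split; last by rewrite mul1g mulg1.
by move=> u _; rewrite tree_act_fix.
Qed.

End Tree.

(** * Conjugacy classes as rotation classes of closed walks *)

Section Counting.
Variables (G : fin_graph) (v0 : fin_vert G).
Local Notation E := (fin_edge G).
Local Notation V := (fin_vert G).
Local Notation inv := (@fin_inv G).
Local Notation X := (trivial_groups G).
Local Notation T := (@bass_serre_tree X v0).
Local Notation Gamma := (@pi1 X v0).
Implicit Types (e f : E) (p r : seq E) (a b : V) (x y z : path_group X).
Implicit Types (u : vert T) (g h : Gamma).
Local Notation invK := (@fin_invK G).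
Local Notation nonback := (nonback inv).
Local Notation step := (@step G).

Lemma path_step e p f : path step e (rcons p f) <->
  path nonback e (rcons p f) /\ @is_walk X (fin_tgt e) p (fin_src f).
Proof.
elim: p e => [|d p IH] e /=.
  by rewrite !andbT /step; split=> [/andP[/eqP]|[nb /eqP tf]] //; apply/andP.
rewrite /step.
split=> [/andP[/andP[/eqP td nb] /IH[pd w]]|[/andP[nb pd] [/eqP td w]]].
  by rewrite nb pd.
by rewrite eq_sym td nb; apply/IH.
Qed.

Lemma walk_head a p b f : p != [::] -> @is_walk X a p b -> a = fin_src (head f p).
Proof. by case: p => //= e p _ []. Qed.

Lemma cycle_stepP p : p != [::] ->
  cycle step p <-> (exists2 b, @is_walk X b p b & cycle nonback p).
Proof.
case: p => // e p _; rewrite /= path_step; split=> [[pe w]|[b [<- w] pe]] //.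
by exists (fin_src e).
Qed.

Definition mkpi1 z (pz : @pg_path X v0 v0 z) : Gamma :=
  exist (fun z => z \in @pi1_pred X v0) z (asboolT pz).

(** A conjugator reduces to [conj_cyc_rot]. Conversely, the rotation by [k] is conjugation by the
    first [k] letters of [p], closed up to a loop at [v0] through [x] and [x']. *)
Lemma core_conj g g' p p' : core g p -> core g' p' ->
  (exists h, g' = h^-1 * g * h) <-> (exists k, p' = rot k p).
Proof.
move=> [b [x [px p0 wp cp eg]]] [b' [x' [px' p0' wp' cp' eg']]].
split=> [[h eh]|[k ek]].
  apply: (conj_cyc_rot (s := nf (x^-1 * val h * x'))) => //.
    exact: nf_reduced.
  have eh' : val g' = (val h)^-1 * val g * val h by rewrite eh.
  rewrite pg_edgesK !invMg invgK !mulgA.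
  apply: (mulgI x'); apply: (mulIg x'^-1); rewrite -eg' eh' eg !mulgA.
  by rewrite mulgK mulgV mul1g.
have : @is_walk X b (take k p ++ drop k p) b by rewrite cat_take_drop.
move=> /walk_cat[c w1 w2].
(* After [k] letters the walk stands at the source of the first letter of [p'], which is the base
   point of [p']. *)
have cb : c = b'.
  have w3 : @is_walk X c p' c by rewrite ek; apply/walk_cat; exists b.
  have f : E by case: (p) p0.
  by rewrite (walk_head f p0' w3) (walk_head f p0' wp').
have ph : @pg_path X v0 v0 (x * pg_edges (take k p) * x'^-1).
  apply: pg_pathM (pg_pathV px'); apply: pg_pathM px _.
  by apply: walk_pg_path; rewrite -cb.
exists (mkpi1 ph); apply: val_inj.
rewrite eg' ek rot_conj; set y := pg_edges _.
transitivity ((x * y * x'^-1)^-1 * val g * (x * y * x'^-1)); last by [].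
by rewrite eg !invMg invgK !mulgA !mulgKV.
Qed.

Lemma core_conjg g h p : core g p -> core (h^-1 * g * h) p.
Proof.
move=> [b [x [px p0 wp cp eg]]]; exists b, (val h^-1 * x); split=> //.
  by apply: pg_pathM px; exact: pi1P.
transitivity ((val h)^-1 * val g * val h); first by [].
rewrite eg.
transitivity ((val h)^-1 * x * pg_edges p * ((val h)^-1 * x)^-1); last by [].
by rewrite invMg invgK !mulgA.
Qed.

Lemma val_pi1X h n : val (h ^+ n) = val h ^+ n.
Proof. by elim: n => // n IH; rewrite !expgS -IH. Qed.

Lemma conjX x y n : (x * y * x^-1) ^+ n = x * y ^+ n * x^-1.
Proof.
elim: n => [|n IH]; first by rewrite !expg0 mulg1 mulgV.
by rewrite !expgS IH !mulgA mulgKV.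
Qed.

Lemma walk_pow a p n : @is_walk X a p a -> @is_walk X a (pow p n) a.
Proof. by move=> w; elim: n => //= n IH; apply/walk_cat; exists a. Qed.

Lemma core_pow h p n : core h p -> core (h ^+ n.+1) (pow p n.+1).
Proof.
move=> [b [x [px p0 wp cp eg]]]; exists b, x; split=> //.
- by case: p p0 {wp cp eg}.
- exact: walk_pow.
- exact: cycle_nonback_flatten.
- by rewrite val_pi1X eg conjX pg_edges_pow.
Qed.

(** The word [v] is itself a closed walk, because its first copy and the remaining copies start with
    the same letter. So a root of the word gives a root of [h] in the group. *)
Lemma core_root h p n d : core h p -> p = pow (take d p) n.+2 ->
  exists k, h = k ^+ n.+2.
Proof.
move=> [b [x [px p0 wp cp eg]]]; set v := take d p => ep.
have v0' : v != [::].
  by apply: contraNneq p0 => v0'; rewrite ep v0'; elim: (n).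
have [c w1 w2] : exists2 c, @is_walk X b v c & @is_walk X c (pow v n.+1) b.
  by apply/walk_cat; rewrite ep in wp.
have bc : b = c.
  have f : E by case: (p) p0.
  rewrite (walk_head f _ w1) // (walk_head f _ w2); last by case: (v) v0'.
  by case: (v) v0'.
have pk : @pg_path X v0 v0 (x * pg_edges v * x^-1).
  apply: pg_pathM (pg_pathV px); apply: pg_pathM px _.
  by apply: walk_pg_path; rewrite {2}bc.
exists (mkpi1 pk); apply: val_inj; rewrite val_pi1X.
transitivity ((x * pg_edges v * x^-1) ^+ n.+2) => //.
by rewrite conjX -pg_edges_pow -ep.
Qed.

(** Induction on the translation length, which is multiplied by the exponent when a power is
    taken. *)
Lemma primitive_root_exists g : g <> 1 ->
  exists h n, [/\ hyperbolic h, primitive h & g = h ^+ n.+1].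
Proof.
move: {2}(translation_length g).+1 (ltnSn (translation_length g)) => n.
elim: n g => // n IH g; rewrite ltnS => len g1.
have [pg|npg] := pselect (primitive g).
  by exists g, 0%N; split=> //; apply/hyperbolicE.
have [k [r [r1 ek]]] : exists (k : Gamma) (r : nat), 1 < r /\ g = k ^+ r.
  apply: contrapT => nex; apply: npg => k r r1 ek; apply: nex.
  by exists k, r.
have k1 : k <> 1 by move=> k1; apply: g1; rewrite ek k1 expg1n.
have [p cp] := core_exists k1.
case: r r1 ek => [|[|r]] // _ ek.
have cg : core g (pow p r.+2) by rewrite ek; exact: core_pow.
have szp : 0 < size p by case: cp => b [x [_ p0 _ _ _]]; case: (p) p0.
case: (IH k) => [||h [s [hh hp eh]]] //.
  move: len; rewrite (core_translation cg) (core_translation cp) size_pow.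
  by apply: leq_trans; exact: ltn_Pmull.
exists h, (s.+1 * r.+2).-1; split=> //.
by rewrite prednK ?muln_gt0 // expgM -eh.
Qed.

(** If [g] is a power of a primitive [h] with core [p], then [t] is a rotation of that power of [p].
    The number [d] of distinct rotations of [t] divides [size p]; were it smaller, [p] and hence [h]
    would be a proper power. *)
Lemma core_primitive_length m (t : m.-tuple E) g :
  core g t -> primitive_length g = order (@rot1 E m) t.
Proof.
move=> cg; have m_gt0 : 0 < m.
  by case: cg => b [x [_ p0 _ _ _]]; rewrite -(size_tuple t); case: (tval t) p0.
have len h n : hyperbolic h -> primitive h -> g = h ^+ n.+1 ->
    translation_length h = order (@rot1 E m) t.
  move=> /hyperbolicE h1 ph eg; have [p cp] := core_exists h1.
  rewrite (core_translation cp).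
  have [k et] : exists k, tval t = rot k (pow p n.+1).
    have cpow : core g (pow p n.+1) by rewrite eg; exact: core_pow.
    apply/(core_conj cpow cg).
    by exists 1; rewrite invg1 mul1g mulg1.
  have szm : m = (n.+1 * size p)%N by rewrite -(size_tuple t) et size_rot size_pow.
  have p0 : p != [::] by case: cp => b [x []].
  have szp : 0 < size p by case: (p) p0.
  set d := order _ t.
  have dvd : d %| size p.
    apply: order_rot1_dvdn; first by rewrite szm leq_pmull.
    by rewrite et rot_rot rot_pow.
  have rotd : rot d (pow p n.+1) = pow p n.+1.
    have -> : pow p n.+1 = rotr k t by rewrite et rotK.
    by rewrite rot_rotr rot_order_rot1.
  have ep := pow_root (ltn0Sn n) dvd rotd.
  have d_gt0 : 0 < d by exact: fingraph.order_gt0.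
  (* Quotient 0 would make [p] empty, 1 is the claim, and at least 2 contradicts primitivity. *)
  case ej : (size p %/ d)%N ep => [|[|j]] ep.
  - by rewrite ep in p0.
  - by rewrite -(divnK dvd) ej mul1n.
  - have [k0 ek0] := core_root cp ep.
    by case: (ph k0 j.+2).
apply: least_eq.
  have [h [n [hh hp eg]]] := primitive_root_exists (core_neq1 cg).
  by exists h; [split=> //; exists n.+1|exact: len eg].
move=> _ [h [hh hp [[//|n] _ eg]] <-].
by rewrite (len h n).
Qed.

Definition core_class p : set Gamma := [set g | core g p].

Lemma core_class_conj g p : core g p -> core_class p = conj_class g.
Proof.
move=> cg; apply/seteqP; split=> h /=.
  move=> ch; have [|k ->] := (core_conj cg ch).2; first by exists 0%N; rewrite rot0.
  by exists k.
by move=> [k _ <-]; exact: core_conjg.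
Qed.

Section Classes.
Variable m : nat.
Hypothesis m_gt0 : 0 < m.
Hypothesis conn : forall a, exists p, @is_walk X v0 p a.

Implicit Types t : m.-tuple E.

Lemma tuple_neq0 t : tval t != [::].
Proof. by rewrite -size_eq0 size_tuple -lt0n. Qed.

(** Connectedness supplies a path from [v0] to the base point of [t], which turns [t] into a loop at
    [v0]. *)
Lemma cycle_core t : cycle step t -> exists g, core g t.
Proof.
move=> /(cycle_stepP (tuple_neq0 t))[b wb cb]; have [p wp] := conn b.
have px := walk_pg_path wp.
have pg : @pg_path X v0 v0 (pg_edges p * pg_edges t * (pg_edges p)^-1).
  apply: pg_pathM (pg_pathV px); apply: pg_pathM px _; exact: walk_pg_path.
by exists (mkpi1 pg), b, (pg_edges p); split=> //; exact: tuple_neq0.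
Qed.

Lemma core_cycle g p : core g p -> cycle step p.
Proof. by move=> [b [x [_ p0 wp cp _]]]; apply/(cycle_stepP p0); exists b. Qed.

Lemma core_class_eq t t' : cycle step t ->
  cycle step t' && (core_class t' == core_class t) = fconnect (@rot1 E m) t t'.
Proof.
move=> ct; have [g cg] := cycle_core ct; apply/idP/idP.
  move=> /andP[ct' /eqP eqc]; have [g' cg'] := cycle_core ct'.
  have : core_class t g' by rewrite -eqc.
  rewrite (core_class_conj cg) => -[h _ eh].
  have [|k ek] := (core_conj cg cg').1; first by exists h.
  apply/fconnect_rot1P; exists (minn k m); first exact: geq_minr.
  by rewrite [LHS]ek rot_minn size_tuple.
move=> /fconnect_rot1P[k _ ek].
have ct' : cycle step t' by rewrite ek rot_cycle.
rewrite ct' /=; have [g' cg'] := cycle_core ct'.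
have [|h eh] := (core_conj cg cg').2; first by exists k.
apply/eqP; rewrite (core_class_conj cg) (core_class_conj cg').
rewrite -(core_class_conj cg); rewrite eh.
have cg'' : core g' t by rewrite eh; exact: core_conjg.
by rewrite -eh -(core_class_conj cg'').
Qed.

Lemma hyperbolic_classesE : @hyperbolic_classes X v0 m =
  [set` undup (map (fun t => core_class t)
                   (enum [pred t : m.-tuple E | cycle step t]))].
Proof.
apply/seteqP; split=> c /=.
  move=> [g [/hyperbolicE g1 lg] <-].
  have [p cp] := core_exists g1.
  have szp : size p == m by rewrite -lg (core_translation cp).
  rewrite mem_undup; apply/mapP; exists (Tuple szp).
    by rewrite mem_enum inE /=; exact: core_cycle cp.
  by rewrite -(core_class_conj cp).
rewrite mem_undup => /mapP[t]; rewrite mem_enum inE => ct ->.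
have [g cg] := cycle_core ct; exists g; last by rewrite -(core_class_conj cg).
split; first by apply/hyperbolicE; exact: core_neq1 cg.
by rewrite (core_translation cg) size_tuple.
Qed.

(** The classes are the rotation orbits, and each is weighted by its own size over 1, so the sum
    counts all tuples. *)
Lemma N_trivial_groups (R : realType) :
  @N X v0 R m = (#|[pred t : m.-tuple E | cycle step t]|%:R%:E)%R.
Proof.
rewrite /N hyperbolic_classesE.
set s := enum _; set C := undup _.
rewrite esum_fset; [|exact: finite_seq|]; last first.
  by move=> c _; rewrite lee_fin Num.Theory.divr_ge0.
rewrite -fsbig_seq ?undup_uniq //.
have summand c : c \in C ->
   ((primitive_length (xget 1%g c))%:R /
     #|` fset_set (cent_axis_stab (xget 1%g c))|%:R)%R%:E =
   ((count (fun t : m.-tuple E => core_class t == c) s)%:R%:E)%R :> \bar R.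
  rewrite mem_undup => /mapP[t]; rewrite mem_enum inE => ct ->.
  have [g cg] := cycle_core ct.
  (* The class is nonempty, so [xget] returns a member and not the default 1. *)
  have cx : core (xget 1%g (core_class t)) t.
    by case: xgetP => [y _ //|/(_ g)[]].
  rewrite (core_primitive_length cx) (cent_axis_stab_trivial cx).
  rewrite fset_set1 cardfs1 GRing.divr1 /order.
  congr (_%:R%:E)%R; rewrite -size_filter.
  rewrite -(card_uniqP (filter_uniq _ (enum_uniq _))); apply: eq_card => t'.
  rewrite mem_filter mem_enum !inE andbC.
  by rewrite core_class_eq.
rewrite (eq_big_seq _ summand) sumEFin -GRing.natr_sum; congr (_%:R%:E)%R.
(* Double counting: every tuple lies in exactly one of the listed classes. *)
under eq_bigr do rewrite -sum1_count big_mkcond.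
rewrite exchange_big /= cardE -/s -sum1_size big_seq [RHS]big_seq.
apply: eq_bigr => t ts.
rewrite -big_mkcond sum1_count (eq_count (a2 := pred1 (core_class t))); last first.
  by move=> c; rewrite /= eq_sym.
rewrite count_uniq_mem ?undup_uniq // (_ : _ \in C) //.
by rewrite mem_undup; apply/mapP; exists t.
Qed.

End Classes.
End Counting.

Lemma card_eq_pred (T : finType) (P : pred T) : [set x | P x] #= `I_#|P|.
Proof.
have -> : [set x | P x] = [set` [fset x | x in P]%fset].
  by apply/seteqP; split=> x /=; rewrite !inE.
by apply/card_eq_fsetP; rewrite card_imfset //= -cardE.
Qed.

(** The tree is a covering: projection maps the edges at a tree vertex bijectively onto those at its
    image. *)
Lemma regular_trivial (G : fin_graph) (v0 : fin_vert G) d :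
  (forall a : fin_vert G, #|[pred e | fin_src e == a]| = d) ->
  @regular d (trivial_groups G) v0.
Proof.
move=> regG u; have [a [x [px ->]]] := tpoint_surj u.
set A := [set d | _].
pose f (d : edge (@bass_serre_tree (trivial_groups G) v0)) : fin_edge G :=
  (sval d).1.
have finj : {in A &, injective f}.
  move=> d1 d2; rewrite !inE.
  have [e1 [x1 [px1 ->]]] := tarc_surj d1.
  have [e2 [x2 [px2 ->]]] := tarc_surj d2.
  rewrite /A /= => /(src_tarc px1 px)[_ ex1] /(src_tarc px2 px)[_ ex2].
  rewrite /f /= => e12; apply: eq_exist.
  by rewrite /= ex1 ex2 e12.
rewrite -(card_eql (inj_card_eq finj)).
have -> : f @` A = [set e | fin_src e == a].
  apply/seteqP; split=> e /=.
    move=> [d0]; have [e1 [x1 [px1 ->]]] := tarc_surj d0.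
    by move=> /(src_tarc px1 px)[<- _] <-; rewrite /f /=.
  move=> /eqP ea; subst a.
  by exists (tarc px) => //; apply/src_tarc.
by rewrite -(regG a); exact: card_eq_pred.
Qed.

(** * The trace formula *)

Import Order.TTheory GRing.Theory Num.Theory.
Import numFieldNormedType.Exports.
Local Open Scope ring_scope.

Section ClosedWalks.
Variables (K : comNzRingType) (T : finType) (r : rel T).

Definition rel_mx : 'M[K]_#|T| :=
  \matrix_(i, j) (r (enum_val i) (enum_val j))%:R.

Lemma sum_enum_val (F : T -> K) : \sum_(i < #|T|) F (enum_val i) = \sum_x F x.
Proof. by rewrite [RHS](reindex _ (onW_bij _ (enum_val_bij T))). Qed.

Lemma sum_tuple_cons k (F : k.+1.-tuple T -> K) :
  \sum_(t : k.+1.-tuple T) F t =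
  \sum_x \sum_(s : k.-tuple T) F [tuple of x :: s].
Proof.
rewrite pair_big (reindex (fun p : T * k.-tuple T => [tuple of p.1 :: p.2])) //=.
exists (fun t => (thead t, [tuple of behead t])).
  by move=> [x s] _ /=; congr (_, _); apply: val_inj.
by move=> t _; rewrite [RHS]tuple_eta; apply: val_inj.
Qed.

(** The tuple [s] lists the [k] intermediate points of a walk with [k.+1] steps. *)
Lemma rel_mxX k i j : (rel_mx ^+ k.+1) i j =
  \sum_(s : k.-tuple T) (path r (enum_val i) (rcons s (enum_val j)))%:R.
Proof.
elim: k i => [|k IH] i.
  rewrite expr1 mxE (big_pred1 [tuple]) /= ?andbT // => s.
  by rewrite [s]tuple0; apply/esym/eqP; exact: val_inj.
rewrite exprS mxE sum_tuple_cons.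
under eq_bigr => l _ do rewrite IH mxE.
rewrite (sum_enum_val (fun x => (r (enum_val i) x)%:R *
  (\sum_(s : k.-tuple T) (path r x (rcons s (enum_val j)))%:R))).
apply: eq_bigr => x _; rewrite mulr_sumr; apply: eq_bigr => s _ /=.
by rewrite -natrM mulnb.
Qed.

Lemma card_cycle k :
  #|[pred t : k.+1.-tuple T | cycle r t]|%:R = \tr (rel_mx ^+ k.+1).
Proof.
rewrite -sum1_card natr_sum big_mkcond /= sum_tuple_cons /mxtrace.
under [RHS]eq_bigr => i _ do rewrite rel_mxX.
rewrite (sum_enum_val (fun x => \sum_(s : k.-tuple T) (path r x (rcons s x))%:R)).
apply: eq_bigr => x _; apply: eq_bigr => s _.
by rewrite inE /=; case: path.
Qed.

End ClosedWalks.

(* The Dickson polynomial of the first kind: its value at a + b is a^m + b^m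
   when a * b = q. *)
Fixpoint dickson (R : pzRingType) (q : nat) (x : R) (m : nat) : R :=
  match m with
  | 0 => 2
  | 1 => x
  | (m'.+1 as k).+1 => dickson q x k * x - dickson q x m' *+ q
  end.

Section Dickson.
Variables (R : pzRingType) (q : nat).

Lemma dicksonSS (x : R) m :
  dickson q x m.+2 = dickson q x m.+1 * x - dickson q x m *+ q.
Proof. by []. Qed.

Lemma nat_ind2 (P : nat -> Prop) :
  P 0 -> P 1 -> (forall m, P m -> P m.+1 -> P m.+2) -> forall m, P m.
Proof.
move=> P0 P1 PS m; suff [] : P m /\ P m.+1 by [].
by elim: m => [|m [Pm PSm]]; split=> //; exact: PS.
Qed.

End Dickson.

Lemma rmorph_dickson (R S : pzRingType) (f : {rmorphism R -> S}) q x m :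
  f (dickson q x m) = dickson q (f x) m.
Proof.
elim/nat_ind2: m => [||m IH0 IH1] //; first exact: rmorph_nat.
by rewrite !dicksonSS rmorphB rmorphM rmorphMn IH0 IH1.
Qed.

Lemma mulmxnr (R : pzRingType) m n p (A : 'M[R]_(m, n)) (B : 'M[R]_(n, p)) k :
  A *m (B *+ k) = (A *m B) *+ k.
Proof. exact: (raddfMn (mulmx A)). Qed.

Lemma mulmxnl (R : pzRingType) m n p (A : 'M[R]_(m, n)) (B : 'M[R]_(n, p)) k :
  (A *+ k) *m B = (A *m B) *+ k.
Proof. by rewrite -!scaler_nat scalemxAl. Qed.

Lemma subrACA (U : zmodType) (x y z t : U) : x - y - (z - t) = x - z - (y - t).
Proof. by rewrite !opprD addrACA. Qed.

(** * The Ihara-Bass relation for regular graphs *)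

Section Ihara.
Variables (K : comNzRingType) (G : fin_graph) (q : nat).
Hypothesis reg : forall a : fin_vert G, #|[pred e | fin_src e == a]| = q.+1.
Local Notation E := (fin_edge G).
Local Notation V := (fin_vert G).
Local Notation inv := (@fin_inv G).
Local Notation step := (@step G).
Local Notation invK := (@fin_invK G).

Definition incidence (f : E -> V) : 'M[K]_(#|V|, #|E|) :=
  \matrix_(v, e) (f (enum_val e) == enum_val v)%:R.

Definition inv_mx : 'M[K]_#|E| :=
  \matrix_(i, j) (enum_val j == inv (enum_val i))%:R.

Local Notation S := (incidence (@fin_src G)).
Local Notation T := (incidence (@fin_tgt G)).
Local Notation J := inv_mx.
Local Notation B := (rel_mx K step).

Definition adjacency : 'M[K]_#|V| := S *m T^T.
Local Notation A := adjacency.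

Lemma incidence_inv f : incidence f *m J = incidence (f \o inv).
Proof.
apply/matrixP => v e; rewrite !mxE /=.
under eq_bigr => d _ do rewrite !mxE.
rewrite (sum_enum_val (fun d => (f d == enum_val v)%:R *
  (enum_val e == inv d)%:R)).
rewrite (bigD1 (inv (enum_val e))) //= invK eqxx mulr1 big1 ?addr0 // => d.
by rewrite -(inj_eq (can_inj invK)) invK eq_sym => /negPf->; rewrite mulr0.
Qed.

Lemma src_inv_mx : S *m J = T.
Proof.
by rewrite incidence_inv; apply/matrixP => v e; rewrite !mxE /= fin_src_inv.
Qed.

Lemma inv_mx2 : J *m J = 1%:M.
Proof.
apply/matrixP => i j; rewrite !mxE; under eq_bigr => d _ do rewrite !mxE.
rewrite (sum_enum_val (fun d => (d == inv (enum_val i))%:R *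
  (enum_val j == inv d)%:R)).
rewrite (bigD1 (inv (enum_val i))) //= invK eqxx mul1r big1 ?addr0 => [|d].
  by rewrite (inj_eq enum_val_inj) eq_sym.
by move=> /negPf->; rewrite mul0r.
Qed.

Lemma tgt_inv_mx : T *m J = S.
Proof. by rewrite -src_inv_mx -mulmxA inv_mx2 mulmx1. Qed.

Lemma tr_inv_mx : J^T = J.
Proof.
apply/matrixP => i j; rewrite !mxE -(inj_eq (can_inj invK)) invK.
by rewrite eq_sym.
Qed.

Lemma inv_mx_trs : J *m S^T = T^T.
Proof. by rewrite -src_inv_mx trmx_mul tr_inv_mx. Qed.

Lemma inv_mx_trt : J *m T^T = S^T.
Proof. by rewrite -tgt_inv_mx trmx_mul tr_inv_mx. Qed.

Lemma tgt_srcT : T *m S^T = A.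
Proof. by rewrite -src_inv_mx -mulmxA inv_mx_trs. Qed.

Lemma src_srcT : S *m S^T = (q.+1)%:R%:M.
Proof.
apply/matrixP => v w; rewrite !mxE; under eq_bigr => d _ do rewrite !mxE.
rewrite (sum_enum_val (fun d => (fin_src d == enum_val v)%:R *
  (fin_src d == enum_val w)%:R)).
case: (eqVneq v w) => [<-|nvw].
  rewrite mulr1n -(reg (enum_val v)) -sum1_card natr_sum [RHS]big_mkcond /=.
  by apply: eq_bigr => e _; rewrite inE -natrM mulnb andbb; case: eqP.
rewrite big1 // => e _; rewrite -natrM mulnb.
case: eqVneq => //= ->; rewrite (inj_eq enum_val_inj).
by rewrite (negPf nvw).
Qed.

Lemma tgt_tgtT : T *m T^T = (q.+1)%:R%:M.
Proof. by rewrite -{1}src_inv_mx -mulmxA inv_mx_trt src_srcT. Qed.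

(** The product T^T S allows all continuations of an edge. Its inverse is always one of them and is
    removed by [J]. *)
Lemma rel_mx_step : B = T^T *m S - J.
Proof.
apply/matrixP => i j; rewrite !mxE; under eq_bigr => d _ do rewrite !mxE.
rewrite (sum_enum_val (T := V) (fun v => (fin_tgt (enum_val i) == v)%:R *
  (fin_src (enum_val j) == v)%:R)).
rewrite (bigD1 (fin_tgt (enum_val i))) //= eqxx mul1r big1 => [|v]; last first.
  by rewrite eq_sym => /negPf->; rewrite mul0r.
rewrite addr0 /step /nonback eq_sym.
case: (eqVneq (enum_val j)) => [->|_]; last by rewrite andbT subr0.
by rewrite andbF fin_src_inv eqxx subrr.
Qed.

(* These two relations let B act on the span of the lifts T^T and S^T of vertex
   vectors, which is where the Ihara-Bass factor x^2 - A x + q comes from. *)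
Lemma step_trt : B *m T^T = T^T *m A - S^T.
Proof. by rewrite rel_mx_step mulmxBl -mulmxA inv_mx_trt. Qed.

Lemma step_trs : B *m S^T = T^T *+ q.
Proof.
rewrite rel_mx_step mulmxBl -mulmxA inv_mx_trs src_srcT mul_mx_scalar.
by rewrite scaler_nat mulrSr addrK.
Qed.

Lemma step2 : B *m B = 1%:M + (T^T *m A *m S - T^T *m T - S^T *m S).
Proof.
rewrite {2}rel_mx_step mulmxBr mulmxA step_trt rel_mx_step !mulmxBl.
rewrite inv_mx2 -!mulmxA src_inv_mx opprB addrC -!addrA; congr (_ + _).
by rewrite addrCA.
Qed.

(* \tr (trace_mx m) = \tr (B ^+ m *m (B *m B - 1%:M)): cyclicity of the trace
   moves the computation from edges to vertices. *)
Definition trace_mx m : 'M[K]_#|V| :=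
  S *m (B ^+ m *m T^T) *m A - T *m (B ^+ m *m T^T) - S *m (B ^+ m *m S^T).

Lemma trace_step m : \tr (B ^+ m.+2) - \tr (B ^+ m) = \tr (trace_mx m).
Proof.
have -> : B ^+ m.+2 = B ^+ m *m (B *m B) by rewrite -[m.+2]addn2 exprD.
rewrite step2 mulmxDr mulmx1 linearD /= addrC addKr.
have trB d (M N : 'M[K]_d) : \tr (M - N) = \tr M - \tr N by exact: linearB.
rewrite /trace_mx !mulmxBr !trB !mulmxA; congr (_ - _ - _).
- by rewrite mxtrace_mulC !mulmxA.
- by rewrite mxtrace_mulC !mulmxA.
- by rewrite mxtrace_mulC !mulmxA.
Qed.

(** Combining the two relations, B^m T^T and B^m S^T each satisfy the recurrence with characteristic
    polynomial x^2 - A x + q, hence so does their combination. *)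
Lemma trace_mxSS m : trace_mx m.+2 = trace_mx m.+1 *m A - trace_mx m *+ q.
Proof.
have recT k : B ^+ k.+2 *m T^T = B ^+ k.+1 *m T^T *m A - (B ^+ k *m T^T) *+ q.
  rewrite exprSr -[B ^+ k.+1 * B]/(B ^+ k.+1 *m B) -mulmxA step_trt mulmxBr mulmxA.
  congr (_ - _); rewrite exprSr -[B ^+ k * B]/(B ^+ k *m B) -mulmxA step_trs.
  by rewrite mulmxnr.
have recS k : B ^+ k.+2 *m S^T = B ^+ k.+1 *m S^T *m A - (B ^+ k *m S^T) *+ q.
  rewrite exprSr -[B ^+ k.+1 * B]/(B ^+ k.+1 *m B) -mulmxA step_trs mulmxnr.
  rewrite exprSr -[B ^+ k * B]/(B ^+ k *m B) -!mulmxA step_trt (mulmxA B) step_trs.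
  by rewrite mulmxBr mulmxnl mulmxnr mulrnBl.
rewrite /trace_mx recT recS !mulmxBr !mulmxBl !mulmxnr !mulmxnl !mulmxA.
by rewrite !mulrnBl [X in X - _ = _]subrACA [LHS]subrACA.
Qed.

(** Both sides satisfy the same second-order recurrence, so the cases 0 and 1 suffice; there S S^T =
    T T^T = (q + 1) I enters. *)
Lemma trace_mx_dickson m :
  trace_mx m = dickson q A m.+2 - dickson q A m.
Proof.
have q1 (x : 'M[K]_#|V|) : (q.+1)%:R%:M *m x = x *+ q.+1.
  by rewrite mul_scalar_mx scaler_nat.
have q1M : (q.+1)%:R%:M = 1 *+ q.+1 :> 'M[K]_#|V| by rewrite -(q1 1) mulmx1.
elim/nat_ind2: m => [||m IH0 IH1].
- rewrite /trace_mx expr0 !mul1mx -/A tgt_tgtT src_srcT q1M /= mulrnDl.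
  rewrite -!addrA; congr (_ + _); rewrite -!opprD; congr (- _).
  by rewrite mulrSr addrACA.
- rewrite /trace_mx expr1 step_trt step_trs !mulmxBr !mulmxnr (mulmxA S) (mulmxA T) -/A.
  rewrite tgt_tgtT tgt_srcT src_srcT q1 mulmxBl q1 /= mulrBl !mulmxE.
  rewrite mulrnAl mulr_natl mulr2n mulrnDl mulrSr addrK !opprD !addrA.
  by rewrite (addrAC _ (- A)) (addrAC _ (- A)).
rewrite trace_mxSS IH0 IH1 [in RHS]dicksonSS [dickson _ _ m.+2 in RHS]dicksonSS.
by rewrite mulmxBl mulrnBl subrACA.
Qed.

(** The differences telescope in steps of two, leaving the discrepancies at 0 and 1. At 1 there is
    none, since [J] has zero diagonal: no edge is its own inverse. *)
Lemma trace_stepE m : \tr (B ^+ m) =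
  \tr (dickson q A m) + (if odd m then 0 else (#|E|%:R - #|V|%:R *+ 2)).
Proof.
elim/nat_ind2: m => [||m IH0 IH1].
- rewrite /= expr0 mxtrace1 mulr2n linearD /= mxtrace1 mulr2n.
  by rewrite addrC subrK.
- rewrite expr1 /= addr0 rel_mx_step linearB /= /adjacency mxtrace_mulC.
  rewrite [X in _ - X]big1 ?subr0 // => i _; rewrite mxE.
  by case: eqP => // /esym/fin_inv_neq.
have := trace_step m; rewrite trace_mx_dickson linearB /= => /eqP.
rewrite subr_eq => /eqP ->; rewrite IH0 negbK [in RHS]addrC.
by rewrite addrA subrK addrC.
Qed.

Lemma card_edges : #|E| = (q.+1 * #|V|)%N.
Proof.
rewrite -sum1_card (partition_big (@fin_src G) xpredT) //=.
under eq_bigr => a _ do rewrite sum1_card (reg a).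
by rewrite sum_nat_const mulnC.
Qed.

(** The length is [m.+1], so [odd m] marks even lengths; regularity turns |E| - 2|V| into (q -
    1)|V|. *)
Lemma card_cycle_dickson m :
  #|[pred t : m.+1.-tuple E | path.cycle step t]|%:R =
  \tr (dickson q A m.+1) + (if odd m then (q%:R - 1) * #|V|%:R else 0) :> K.
Proof.
rewrite card_cycle trace_stepE /= if_neg card_edges; congr (_ + _).
by case: ifP => // _; rewrite natrM -natr1; ring.
Qed.

End Ihara.

(** * Mobius ladders *)

(** The columns of [F] form an eigenbasis of [A], hence of every polynomial in [A]. *)
Lemma dickson_diag (K : comUnitRingType) n q (A F : 'M[K]_n) (lam : 'rV_n) m :
  F \in unitmx -> A *m F = F *m diag_mx lam ->
  \tr (dickson q A m) = \sum_i dickson q (lam 0 i) m.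
Proof.
move=> uF AF.
have dF : dickson q A m *m F = F *m diag_mx (\row_i dickson q (lam 0 i) m).
  elim/nat_ind2: m => [||m IH0 IH1].
  - have -> : \row_i dickson q (lam 0 i) 0 = const_mx 2.
      by apply/rowP => i; rewrite !mxE.
    rewrite diag_const_mx mul_mx_scalar /= mulmxDl mul1mx.
    by rewrite scaler_nat mulr2n.
  - by rewrite /= AF; congr (_ *m diag_mx _); apply/rowP => i; rewrite mxE.
  rewrite dicksonSS mulmxBl mulmxnl IH0 -mulmxE -mulmxA AF mulmxA IH1 -mulmxA.
  rewrite -mulmxnr -mulmxBr; congr (_ *m _); rewrite mulmx_diag.
  rewrite -scaler_nat; apply/matrixP => i j; rewrite !mxE dicksonSS mulr_natl.
  by case: eqP => [->|_]; rewrite ?mulr1n // !mulr0n mul0rn subr0.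
have -> : dickson q A m = F *m diag_mx (\row_i dickson q (lam 0 i) m) *m invmx F.
  by rewrite -dF mulmxK.
rewrite mxtrace_mulC mulKmx // mxtrace_diag.
by apply: eq_bigr => i _; rewrite mxE.
Qed.

Lemma adjacency_mul (K : comNzRingType) (G : fin_graph) n
    (M : 'M[K]_(#|fin_vert G|, n)) (f : fin_vert G -> 'I_n -> K) :
  (forall v j, M v j = f (enum_val v) j) -> forall v j,
  (adjacency K G *m M) v j = \sum_(e | fin_src e == enum_val v) f (fin_tgt e) j.
Proof.
move=> Mf v j; rewrite -mulmxA mxE.
have tM e : ((incidence K (@fin_tgt G))^T *m M) e j = f (fin_tgt (enum_val e)) j.
  rewrite mxE; under eq_bigr => w _ do rewrite !mxE Mf.
  rewrite (sum_enum_val (fun w => (fin_tgt (enum_val e) == w)%:R * f w j)).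
  rewrite (bigD1 (fin_tgt (enum_val e))) //= eqxx mul1r big1 ?addr0 // => w.
  by rewrite eq_sym => /negPf->; rewrite mul0r.
under eq_bigr => e _ do rewrite tM mxE.
rewrite (sum_enum_val (fun e => (fin_src e == enum_val v)%:R * f (fin_tgt e) j)).
rewrite [RHS]big_mkcond; apply: eq_bigr => e _.
by case: ifP; rewrite (mul1r, mul0r).
Qed.

Section Mobius.
Variables (k r : nat).
Local Notation n := (4 * k.+1)%N.

Lemma ladder_size_gt1 : (1 < n)%N. Proof. by rewrite mulnS. Qed.
Local Notation n_gt1 := ladder_size_gt1.

Definition antipode : 'Z_n := (2 * k.+1)%:R.

Lemma antipodeD : antipode + antipode = 0.
Proof.
by rewrite -natrD addnn -mul2n mulnA (pchar_Zp n_gt1).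
Qed.

Lemma antipode_neq0 : antipode != 0.
Proof.
apply/eqP => /(congr1 val); rewrite /= val_Zp_nat ?n_gt1 // modn_small; lia.
Qed.

Local Notation L := (bool + 'I_r)%type.

Definition ladder_shift (l : L) : 'Z_n :=
  match l with inl true => 1 | inl false => -1 | inr _ => antipode end.

(** Reversal keeps the label of an antipodal edge; the edge still differs from its inverse because
    the starting vertex moves. *)
Definition ladder_opp (l : L) : L :=
  match l with inl b => inl (~~ b) | inr i => inr i end.

Definition ladder_tgt (e : 'Z_n * L) : 'Z_n := e.1 + ladder_shift e.2.
Definition ladder_inv (e : 'Z_n * L) : 'Z_n * L :=
  (e.1 + ladder_shift e.2, ladder_opp e.2).

Lemma ladder_shift_opp l : ladder_shift (ladder_opp l) = - ladder_shift l.
Proof.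
case: l => [[]|i] //=; first by rewrite opprK.
by apply/eqP; rewrite -addr_eq0 antipodeD.
Qed.

Lemma ladder_invK : involutive ladder_inv.
Proof.
move=> [v l]; rewrite /ladder_inv /= ladder_shift_opp addrK; congr (_, _).
by case: l => [[]|].
Qed.

Lemma ladder_inv_neq e : ladder_inv e <> e.
Proof.
case: e => v [[]|i] [] //.
by move/eqP; rewrite -[X in _ == X]addr0 (inj_eq (addrI v)) (negPf antipode_neq0).
Qed.

(* The Cayley graph of Z/n with generators 1, -1 and r copies of the involution
   n/2. Since n/2 is even, no character sends 1 and n/2 both to -1, so the graph
   is not bipartite. *)
Definition mobius_ladder : fin_graph :=
  @FinGraph 'Z_n ('Z_n * L)%type fst ladder_tgt ladder_inv ladder_invK
    ladder_inv_neq (fun=> erefl).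
Local Notation G := mobius_ladder.

Lemma ladder_sum_src (K : nmodType) (f : fin_edge G -> K) (v : 'Z_n) :
  \sum_(e : fin_edge G | fin_src e == v) f e = \sum_(l : L) f (v, l).
Proof.
rewrite (reindex (fun l : L => (v, l) : fin_edge G)) /=.
  by apply: eq_bigl => l; rewrite eqxx.
by exists snd => [l _ //|[w l]]; rewrite inE /= => /eqP ->.
Qed.

Lemma ladder_regular (v : fin_vert G) : #|[pred e | fin_src e == v]| = r.+2.
Proof.
rewrite -sum1_card (ladder_sum_src (fun=> 1%N)) sum1_card card_sum card_bool.
by rewrite card_ord.
Qed.

Section Character.
Variables (K : fieldType) (z : K).
Hypothesis zn : z ^+ n = 1.

Lemma expr_ZpD (v w : 'Z_n) : z ^+ (v + w)%R = z ^+ v * z ^+ w.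
Proof. by rewrite /= [X in (_ %% X)%N](Zp_cast n_gt1) expr_mod // exprD. Qed.

Lemma expr_ZpN (v : 'Z_n) : z ^+ (- v)%R = (z ^+ v)^-1.
Proof.
have e1 : z ^+ v * z ^+ (- v)%R = 1 by rewrite -expr_ZpD subrr.
have nz : z ^+ v != 0.
  by apply/eqP => z0; move/eqP: e1; rewrite z0 mul0r eq_sym oner_eq0.
by apply: (mulfI nz); rewrite e1 divff.
Qed.

(** Characters are eigenvectors of a Cayley graph of an abelian group; the eigenvalue is the sum of
    the character over the generators. *)
Lemma ladder_character (v : 'Z_n) :
  \sum_(e : fin_edge G | fin_src e == v) z ^+ (fin_tgt e : 'Z_n) =
  z ^+ v * (z + z^-1 + z ^+ (2 * k.+1) *+ r).
Proof.
rewrite (ladder_sum_src (fun e => z ^+ (fin_tgt e : 'Z_n))).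
have tE l : z ^+ (ladder_tgt (v, l)) = z ^+ v * z ^+ (ladder_shift l).
  exact: expr_ZpD.
under eq_bigr => l _ do rewrite [fin_tgt _]/= tE.
rewrite -mulr_sumr big_sumType /= big_bool sumr_const card_ord.
congr (_ * (_ + _ + _ *+ _)); first exact: expr_ZpN.
by rewrite /antipode val_Zp_nat ?n_gt1 // expr_mod.
Qed.

End Character.

(** The characters form a Vandermonde matrix in the powers of [zeta]. These are distinct, so the
    matrix is invertible and diagonalizes the adjacency matrix. *)
Lemma ladder_trace (K : fieldType) (zeta : K) m :
  n.-primitive_root zeta ->
  \tr (dickson r.+1 (adjacency K G) m) =
  \sum_(0 <= j < n) dickson r.+1
    (zeta ^+ j + zeta ^- j + zeta ^+ (j * (2 * k.+1)) *+ r) m.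
Proof.
move=> zP; have zn := prim_expr_order zP.
have cV : #|'Z_n| = n by rewrite card_ord Zp_cast ?n_gt1.
pose F : 'M[K]_#|'Z_n| := Vandermonde #|'Z_n| (\row_j zeta ^+ j).
pose lam := \row_(j < #|'Z_n|)
  (zeta ^+ j + zeta ^- j + zeta ^+ (j * (2 * k.+1)) *+ r).
have uF : F \in unitmx.
  rewrite unitmxE unitfE det_Vandermonde.
  apply/prodf_neq0 => i _; apply/prodf_neq0 => j ij; rewrite !mxE subr_eq0.
  have ltn (l : 'I_#|'Z_n|) : (l < n)%N by rewrite -[X in (_ < X)%N]cV.
  rewrite (eq_prim_root_expr zP) !modn_small //.
  by rewrite eq_sym neq_ltn ij.
rewrite (@dickson_diag _ _ _ _ F lam) //.
  rewrite -[X in \sum_(_ <= _ < X) _]cV big_mkord.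
  by apply: eq_bigr => j _; rewrite mxE.
apply/matrixP => v j.
have Fv (w i : 'I_#|'Z_n|) : F w i = (zeta ^+ i) ^+ (enum_val w : 'Z_n).
  rewrite !mxE; congr (_ ^+ _).
  by rewrite enum_val_ord.
rewrite (@adjacency_mul K G _ F (fun w i => (zeta ^+ i) ^+ (w : 'Z_n))) //.
rewrite ladder_character; last by rewrite exprAC zn expr1n.
rewrite mul_mx_diag mxE Fv /lam mxE; congr (_ * (_ + _ *+ _)).
by rewrite -exprM.
Qed.

End Mobius.

(** * Complex roots of unity *)

Section Cis.
Local Open Scope complex_scope.
Variable R : realType.
Implicit Types x y : R.

Definition cis x : R[i] := cos x +i* sin x.

Lemma cisD x y : cis (x + y) = cis x * cis y.
Proof.
by rewrite /cis cosD sinD; apply/eqP; rewrite eq_complex /= addrC eqxx addrC eqxx.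
Qed.

Lemma cis0 : cis 0 = 1.
Proof. by rewrite /cis cos0 sin0. Qed.

Lemma cisMn x j : cis (x *+ j) = cis x ^+ j.
Proof. by elim: j => [|j IH]; rewrite ?mulr0n ?cis0 // mulrS cisD IH exprS. Qed.

Lemma cisN x : cis (- x) = (cis x)^-1.
Proof.
have e1 : cis x * cis (- x) = 1 by rewrite -cisD subrr cis0.
have nz : cis x != 0 by apply: contra_eq_neq e1 => ->; rewrite mul0r eq_sym oner_eq0.
by apply: (mulfI nz); rewrite e1 divff.
Qed.

Lemma cis_pi : cis pi = -1.
Proof. by rewrite /cis cospi sinpi; apply/eqP; rewrite eq_complex /= oppr0 !eqxx. Qed.

(** If the order [m] were below [n], the real part would give cos (2x) = 1 with x = pi m / n
    strictly between 0 and pi, where the sine is positive. *)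
Lemma cis_root n : (0 < n)%N -> n.-primitive_root (cis (pi *+ 2 / n%:R)).
Proof.
move=> n_gt0; set z := cis _; have n0 : n%:R != 0 :> R by rewrite pnatr_eq0 -lt0n.
have zn : z ^+ n = 1.
  rewrite /z -cisMn -[_ *+ n]mulr_natr divfK //.
  by rewrite mulr2n cisD cis_pi mulrNN mulr1.
have [m zm dvd] := prim_order_exists n_gt0 zn.
have m_gt0 := prim_order_gt0 zm.
suff /eqP <- : m == n by [].
rewrite eqn_leq dvdn_leq //= leqNgt; apply/negP => lt_mn.
have := prim_expr_order zm; rewrite -cisMn => /(congr1 (@complex.Re R)) /=.
pose x : R := pi / n%:R *+ m.
have -> : (pi *+ 2 / n%:R) *+ m = x *+ 2 by rewrite /x mulrnAl mulrnAC.
have x0 : 0 < x < pi.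
  rewrite /x -mulr_natr mulrAC -mulrA; apply/andP; split.
    by rewrite mulr_gt0 ?pi_gt0 // divr_gt0 // ltr0n.
  rewrite gtr_pMr ?pi_gt0 // ltr_pdivrMr ?ltr0n // mul1r ltr_nat //.
have := sin_gt0_pi x0; rewrite cos_mulr2n cos2sin2 => s0 /eqP.
rewrite -subr_eq0; have : 0 < sin x ^+ 2 by rewrite exprn_gt0.
by move=> s2 /eqP; lra.
Qed.

End Cis.

(** * Closed walks of the ladder through its real spectrum *)

Section LadderCount.
Local Open Scope complex_scope.
Variables (R : realType) (k r : nat).
Local Notation n := (4 * k.+1)%N.
Local Notation G := (mobius_ladder k r).

(** The eigenvalue of the [j]-th character: the cycle edges give the cosine, and each antipodal edge
    gives the value at n/2, which is (-1)^j. *)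
Definition ladder_eigenvalue (j : nat) : R :=
  2 * cos (pi *+ 2 / n%:R *+ j) + r%:R * (-1) ^+ j.

Lemma ladder_count m :
  #|[pred t : m.+1.-tuple (fin_edge G) | path.cycle (@step G) t]|%:R =
  \sum_(0 <= j < n) dickson r.+1 (ladder_eigenvalue j) m.+1 +
  (if odd m then (r * n)%:R else 0) :> R.
Proof.
have n_gt0 : (0 < n)%N by [].
(* The roots of unity live in [R[i]]; the real identity descends along the injection of [R]. *)
apply: (@complexI R); rewrite rmorphD rmorph_sum rmorph_nat.
rewrite (card_cycle_dickson _ (@ladder_regular k r)).
rewrite (ladder_trace _ _ (cis_root R n_gt0)).
congr (_ + _); last first.
  rewrite card_ord (Zp_cast (ladder_size_gt1 k)) -natr1 addrK -natrM.
  by case: ifP => _; rewrite ?rmorph0 // rmorph_nat.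
apply: eq_bigr => j _; rewrite [RHS](rmorph_dickson (real_complex R)).
congr dickson; set th := pi *+ 2 / _.
have -> : cis th ^+ (j * (2 * k.+1)) = (-1) ^+ j.
  rewrite mulnC exprM -cisMn; congr (_ ^+ _); rewrite -cis_pi; congr cis.
  rewrite /th -mulr_natr -mulr_natr !natrM; field.
  by rewrite nat1r pnatr_eq0.
rewrite -cisMn -cisN /ladder_eigenvalue -/th rmorphD !rmorphM rmorphXn rmorphN1.
rewrite !rmorph_nat -[_ *+ r]mulr_natl; congr (_ + _).
by apply/eqP; rewrite eq_complex /= cosN sinN; apply/andP; split; apply/eqP; ring.
Qed.

End LadderCount.

(** * Asymptotics *)

Lemma dickson_roots (K : comPzRingType) q (a b : K) m :
  a * b = q%:R -> dickson q (a + b) m = a ^+ m + b ^+ m.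
Proof.
move=> ab; elim/nat_ind2: m => [||m IH0 IH1].
- by rewrite !expr0.
- by rewrite !expr1.
by rewrite dicksonSS IH0 IH1 -mulr_natr -ab !exprS; ring.
Qed.

Lemma dickson_succ (K : comPzRingType) q m :
  dickson q (q.+1%:R : K) m = q%:R ^+ m + 1.
Proof. by rewrite -natr1 dickson_roots ?mulr1 // expr1n. Qed.

(** * Growth of Dickson polynomials *)

Section DicksonBounds.
Variables (R : rcfType) (q : nat).
Hypothesis q_gt1 : (1 < q)%N.
Implicit Types x rho : R.

Let q_ge2 : 2 <= q%:R :> R. Proof. by rewrite (ler_nat _ 2). Qed.

(** One step of the recurrence multiplies this quadratic form in consecutive terms by [q]. It
    controls the case of complex roots within the real field. *)
Lemma dickson_invariant x m :
  dickson q x m.+1 ^+ 2 - x * dickson q x m.+1 * dickson q x m +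
    q%:R * dickson q x m ^+ 2 = (4 * q%:R - x ^+ 2) * q%:R ^+ m.
Proof.
elim: m => [|m IH]; first by rewrite /=; ring.
rewrite dicksonSS [q%:R ^+ m.+1]exprS [RHS]mulrCA -IH -[_ *+ q]mulr_natl; ring.
Qed.

(** The form is then positive definite, and completing the square bounds each term. *)
Lemma dickson_complex_roots x m : x ^+ 2 < 4 * q%:R ->
  dickson q x m ^+ 2 <= 4 * q%:R ^+ m.
Proof.
move=> hx; have dpos : 0 < 4 * q%:R - x ^+ 2 by rewrite subr_gt0.
rewrite -(ler_pM2l dpos) [leRHS]mulrCA -dickson_invariant -subr_ge0.
set a := dickson q x m.+1; set b := dickson q x m.
have -> : 4 * (a ^+ 2 - x * a * b + q%:R * b ^+ 2) - (4 * q%:R - x ^+ 2) * b ^+ 2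
  = (2 * a - x * b) ^+ 2 by ring.
exact: sqr_ge0.
Qed.

Lemma dickson_real_roots x : 4 * q%:R <= x ^+ 2 ->
  exists a b, [/\ a + b = x, a * b = q%:R, b <= a &
    forall m, dickson q x m = a ^+ m + b ^+ m].
Proof.
move=> hx; set s := Num.sqrt (x ^+ 2 - 4 * q%:R).
have s0 : 0 <= s by exact: sqrtr_ge0.
have s2 : s ^+ 2 = x ^+ 2 - 4 * q%:R by rewrite sqr_sqrtr // subr_ge0.
have ab : (x + s) / 2 * ((x - s) / 2) = q%:R.
  transitivity ((x ^+ 2 - s ^+ 2) / 4); first by field.
  by rewrite s2; field.
exists ((x + s) / 2), ((x - s) / 2); split=> //; first by field.
  by lra.
by move=> m; rewrite -(dickson_roots _ ab); congr dickson; field.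
Qed.

(** Complex roots have modulus sqrt q < q. Real roots have product [q] and a sum of modulus below q
    + 1, which keeps both strictly between -q and q. *)
Lemma dickson_lt_bound x : `|x| < q.+1%:R ->
  exists rho, [/\ 0 <= rho, rho < q%:R & forall m, `|dickson q x m| <= 2 * rho ^+ m].
Proof.
have q2 := q_ge2; rewrite ltr_norml -natr1 => /andP[x1 x2].
case: (ltP (x ^+ 2) (4 * q%:R)) => hx.
  exists (Num.sqrt q%:R); split; first exact: sqrtr_ge0.
    rewrite -(@ltr_pXn2r _ 2) ?nnegrE ?sqrtr_ge0 // sqr_sqrtr // expr2.
    by nra.
  move=> m; rewrite -(@ler_pXn2r _ 2) ?nnegrE ?mulr_ge0 ?exprn_ge0 ?sqrtr_ge0 //.
  rewrite real_normK ?num_real // exprMn exprAC sqr_sqrtr ?ler0n //.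
  apply: le_trans (dickson_complex_roots _ hx) _; lra.
have [a [b [abx abq ba D]]] := dickson_real_roots hx.
have [aq bq] : `|a| < q%:R /\ `|b| < q%:R.
  rewrite !ltr_norml; split; apply/andP; split; nra.
exists (Num.max `|a| `|b|); split; first by rewrite le_max normr_ge0.
  by rewrite gt_max aq bq.
move=> m; rewrite D; apply: le_trans (ler_normD _ _) _; rewrite !normrX.
rewrite mulr2n mulrDl !mul1r lerD //;
  by rewrite lerXn2r ?nnegrE ?le_max ?lexx ?normr_ge0 ?orbT.
Qed.

(** For real roots the even powers are nonnegative; for complex roots the bound 2 q^m on the modulus
    applies. *)
Lemma dickson_even_ge x m : - (2 * q%:R ^+ m) <= dickson q x m.*2.
Proof.
case: (ltP (x ^+ 2) (4 * q%:R)) => hx.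
  have := dickson_complex_roots m.*2 hx; set d := dickson _ _ _ => hd.
  suff : `|d| <= 2 * q%:R ^+ m by rewrite ler_norml => /andP[].
  rewrite -(@ler_pXn2r _ 2) ?nnegrE ?mulr_ge0 ?exprn_ge0 //.
  rewrite real_normK ?num_real // exprMn -exprM muln2.
  apply: le_trans hd _; lra.
have [a [b [_ _ _ ->]]] := dickson_real_roots hx.
rewrite -!mul2n !exprM; apply: le_trans (_ : 0 <= _).
  by rewrite oppr_le0 mulr_ge0 ?exprn_ge0.
by rewrite addr_ge0 // exprn_ge0 // sqr_ge0.
Qed.

(** The polynomial t^2 - x t + q is nonpositive at [rho], so the larger root is at least [rho]; the
    power of the smaller root is nonnegative and is dropped. *)
Lemma dickson_ge rho x m : 0 < rho -> q%:R <= rho ^+ 2 -> rho + q%:R / rho <= x ->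
  rho ^+ m <= dickson q x m.
Proof.
move=> rho0 qrho xrho.
have eqr : q%:R = rho * (q%:R / rho) by field; rewrite gt_eqF.
set t := q%:R / rho in xrho eqr.
have t0 : 0 < t by rewrite divr_gt0 // ltr0n ltnW.
have hx : 4 * q%:R <= x ^+ 2.
  have : 4 * q%:R <= (rho + t) ^+ 2.
    rewrite eqr -subr_ge0 (_ : _ - _ = (rho - t) ^+ 2) ?sqr_ge0 //; ring.
  by move=> /le_trans; apply; rewrite lerXn2r ?nnegrE //; lra.
have [a [b [abx abq ba ->]]] := dickson_real_roots hx.
have a0 : 0 < a by lra.
have b0 : 0 <= b.
  rewrite leNgt; apply/negP => b0; have : 0 <= q%:R :> R by rewrite ler0n.
  rewrite -abq; nra.
have ra : rho <= a.
  rewrite leNgt; apply/negP => ar.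
  have : 0 < (rho - a) * (rho - b) by rewrite mulr_gt0 // subr_gt0 // (le_lt_trans ba).
  have -> : (rho - a) * (rho - b) = rho ^+ 2 - (a + b) * rho + a * b by ring.
  rewrite abx abq eqr; nra.
rewrite -[leLHS]addr0 lerD ?exprn_ge0 // lerXn2r // nnegrE ltW //.
Qed.

End DicksonBounds.

(** * The spectral gap of the ladder and its closing for long ladders *)

Section Eigenvalues.
Variable R : realType.

Lemma ladder_eigenvalue0 k r : ladder_eigenvalue R k r 0 = r.+2%:R.
Proof. by rewrite /ladder_eigenvalue mulr0n cos0 expr0 !mulr1 -natrD add2n. Qed.

(** With y = pi j / n, the eigenvalue is r + 2 - 4 sin^2 y for even [j] and 4 cos^2 y - (r + 2) for
    odd [j]. So the extreme values need sin y = 0 or cos y = 0 respectively. *)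
Lemma ladder_eigenvalue_lt k r j : (0 < r)%N -> (0 < j < 4 * k.+1)%N ->
  `|ladder_eigenvalue R k r j| < r.+2%:R.
Proof.
move=> r_gt0 /andP[j_gt0 j_lt]; rewrite /ladder_eigenvalue.
have n0 : (4 * k.+1)%:R != 0 :> R by rewrite pnatr_eq0.
pose y : R := pi / (4 * k.+1)%:R *+ j.
have -> : pi *+ 2 / (4 * k.+1)%:R *+ j = y *+ 2 by rewrite /y mulrnAl mulrnAC.
have y0 : 0 < y < pi.
  rewrite /y -mulr_natr mulrAC -mulrA; apply/andP; split.
    by rewrite mulr_gt0 ?pi_gt0 // divr_gt0 // ltr0n.
  by rewrite gtr_pMr ?pi_gt0 // ltr_pdivrMr ?ltr0n // mul1r ltr_nat.
have s2 : 0 < sin y ^+ 2 by rewrite exprn_gt0 // sin_gt0_pi.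
have c2 : 0 <= cos y ^+ 2 by rewrite sqr_ge0.
have r1 : 1 <= r%:R :> R by rewrite ler1n.
rewrite cos_mulr2n -signr_odd -addn2 natrD mulr2n ltr_norml.
have := cos2Dsin2 y.
case oj : (odd j) => sc; last by rewrite expr0; apply/andP; split; lra.
suff : 0 < cos y ^+ 2 by rewrite expr1; move=> ?; apply/andP; split; lra.
rewrite lt_neqAle c2 andbT eq_sym sqrf_eq0 -cos_pihalf; apply/eqP => cy.
have := pi_gt0 R => pi0.
have /cos_inj : y \in `[0, pi] by rewrite in_itv /=; move: y0 => /andP[/ltW-> /ltW->].
move=> /(_ (pi / 2)) /(_ _ cy); rewrite in_itv /= => yE.
have {}yE : y = pi / 2 by apply: yE; apply/andP; split; lra.
(* A zero cosine gives 2j = n = 4(k + 1), which contradicts [j] odd. *)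
have : (j * 2)%:R = (4 * k.+1)%:R :> R.
  have /mulfI : pi != 0 :> R by rewrite gt_eqF.
  apply; rewrite natrM -[in LHS](mulKf n0 (pi * _)).
  transitivity (y * 2 * (4 * k.+1)%:R); first by rewrite /y -mulr_natr; field.
  by rewrite yE; field.
by move=> /eqP; rewrite eqr_nat => /eqP ?; lia.
Qed.

(** The index 2 is even, so the antipodal edges contribute [+r], and the angle pi / (k + 1) tends to
    0. *)
Lemma ladder_eigenvalue2_ge r (c : R) : c < r.+2%:R ->
  exists k, c <= ladder_eigenvalue R k r 2.
Proof.
(* The cosine to be reached, raised to 0 if negative so that [acos] applies. *)
move=> hc; pose d := Num.max 0 ((c - r%:R) / 2).
have d01 : 0 <= d < 1.
  rewrite le_max lexx /= gt_max ltr01 ltr_pdivrMr // mul1r.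
  by rewrite ltrBlDl -natrD addn2.
have dN1 : -1 <= d <= 1 by move: d01 => /andP[? ?]; apply/andP; split; lra.
have [a0 a_pi] : 0 < acos d /\ acos d <= pi.
  by split; [apply: acos_gt0; lra|apply: acos_lepi].
have p0 := pi_gt0 R.
(* This choice puts the angle pi / (k + 1) below [acos d]. *)
have [k hk] : exists k : nat, pi / acos d < k.+1%:R.
  exists (Num.bound (pi / acos d)).
  by rewrite (lt_trans (archi_boundP _)) ?ltr_nat // divr_ge0 ?ltW.
exists k; rewrite /ladder_eigenvalue sqrrN expr1n mulr1.
set th := pi *+ 2 / _ *+ 2.
have thE : th = pi / k.+1%:R.
  rewrite /th natrM -[pi *+ 2]mulr_natr -[_ *+ 2 in LHS]mulr_natr.
  by field; rewrite nat1r pnatr_eq0.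
have th1 : 0 <= th <= acos d.
  rewrite thE; apply/andP; split; first by rewrite divr_ge0 // ltW.
  by rewrite ltW // ltr_pdivrMr ?ltr0n // mulrC -ltr_pdivrMr.
have : d <= cos th.
  rewrite -[leLHS]acosK //; move: th1 => /andP[th0 th1].
  rewrite leNgt; apply/negP; rewrite ltr_cos ?in_itv /=; [by lra| |].
    by apply/andP; split; lra.
  by apply/andP; split; lra.
rewrite ge_max ler_pdivrMr // => /andP[_ h].
by rewrite mulrC -lerBlDr.
Qed.

End Eigenvalues.

Definition cyclic_walks (G : fin_graph) (m : nat) : nat :=
  #|[pred t : m.-tuple (fin_edge G) | path.cycle (@step G) t]|.

(** * Upper and lower bounds for the number of closed walks *)

Section Ladder.
Variables (R : realType) (k r : nat).
Hypothesis r_gt0 : (0 < r)%N.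
Local Notation n := (4 * k.+1)%N.
Local Notation q := (r.+1).
Local Notation W := (cyclic_walks (mobius_ladder k r)).
Local Notation lam := (ladder_eigenvalue R k r).

Let q_gt1 : (1 < q)%N. Proof. by []. Qed.

(** The largest of finitely many rates, started at 1 so that bounded terms are dominated as well. *)
Lemma dickson_uniform_bound (l : nat -> R) (N : nat) :
  (forall j, (0 < j < N)%N -> `|l j| < q.+1%:R) ->
  exists rho, [/\ 1 <= rho, rho < q%:R & forall j, (0 < j < N)%N ->
    forall m, `|dickson q (l j) m| <= 2 * rho ^+ m].
Proof.
elim: N => [|N IH] hl.
  by exists 1; split=> // [|j]; rewrite ?ltr1n ?ltn0 ?andbF.
have [j /andP[j0 jN]|rho [rho1 rhoq hrho]] := IH.
  by apply: hl; rewrite j0 ltnW.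
have [N0|N_gt0] := posnP N.
  by exists rho; split=> // j; rewrite N0 ltnS; case: j.
have [|rho' [r0 rq hr]] := dickson_lt_bound (x := l N) q_gt1.
  by apply: hl; rewrite N_gt0 /=.
exists (Num.max rho rho'); split.
- by rewrite le_max rho1.
- by rewrite gt_max rhoq.
move=> j /andP[j0]; rewrite ltnS leq_eqVlt => /orP[/eqP ->|jN] m.
  apply: le_trans (hr m) _; rewrite ler_pM2l //.
  by apply: lerXn2r; rewrite ?nnegrE // le_max ?lexx ?orbT // r0 orbT.
apply: le_trans (hrho j _ m) _; first by rewrite j0.
rewrite ler_pM2l //.
have rho0 : 0 <= rho by exact: le_trans rho1.
by apply: lerXn2r; rewrite ?nnegrE ?le_max ?lexx ?rho0.
Qed.

Lemma cyclic_walksE m : (W m.+1)%:R = q%:R ^+ m.+1 + 1 +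
  \sum_(1 <= j < n) dickson q (lam j) m.+1 +
  (if odd m then (r * n)%:R else 0) :> R.
Proof.
by rewrite /cyclic_walks ladder_count big_ltn // ladder_eigenvalue0 dickson_succ.
Qed.

Lemma cyclic_walks_upper : exists rho C : R,
  [/\ 0 <= rho, rho < q%:R & forall m,
      `|(W m.+1)%:R - q%:R ^+ m.+1| <= C * rho ^+ m.+1].
Proof.
have [j hj|rho [rho1 rhoq hrho]] := @dickson_uniform_bound lam n.
  exact: ladder_eigenvalue_lt.
have rho0 : 0 <= rho by exact: le_trans rho1.
(* The constant collects 1 from the root 1 of the top eigenvalue, 2 for each other eigenvalue, and
   the parity term. *)
exists rho, (1 + (2 * (n - 1)%:R) + (r * n)%:R); split=> // m.
rewrite cyclic_walksE; set Sg := \sum_(_ <= _ < _) _.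
set e := if _ then _ else _; rewrite (_ : _ - _ = 1 + Sg + e); last by ring.
have pw : 1 <= rho ^+ m.+1 by rewrite exprn_ege1.
rewrite 2!mulrDl mul1r; apply: le_trans (ler_normD _ _) _; apply: lerD.
  apply: le_trans (ler_normD _ _) _; rewrite normr1; apply: lerD => //.
  apply: le_trans (ler_norm_sum _ _ _) _.
  rewrite [2 * _]mulrC -mulrA [leRHS]mulr_natl -sumr_const_nat.
  by rewrite big_nat [leRHS]big_nat; apply: ler_sum => j hj; exact: hrho.
rewrite /e; case: ifP => _; last by rewrite normr0 mulr_ge0 // exprn_ge0.
by rewrite normr_nat ler_peMr.
Qed.

(** At even length the index 2 contributes at least a power of [rho], and every other index loses at
    most 2 q^(p + 1). *)
Lemma cyclic_walks_lower (rho : R) p : 0 < rho -> q%:R <= rho ^+ 2 ->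
  rho + q%:R / rho <= lam 2 ->
  rho ^+ 2 ^+ p.+1 - (2 * n)%:R * q%:R ^+ p.+1 <=
  (W p.+1.*2)%:R - q%:R ^+ p.+1.*2.
Proof.
move=> rho0 qrho hlam; rewrite doubleS cyclic_walksE -doubleS.
set e := if _ then _ else _; have e0 : 0 <= e by rewrite /e; case: ifP.
set Q := q%:R ^+ p.+1.
have Q0 : 0 <= Q by rewrite exprn_ge0.
(* Adding [2 * Q] makes every summand nonnegative, so all but the one of index 2 may be dropped. *)
have hsum : rho ^+ 2 ^+ p.+1 <=
    \sum_(1 <= j < n) (dickson q (lam j) p.+1.*2 + 2 * Q).
  have n2 : 2 \in index_iota 1 n by rewrite mem_index_iota mulnS.
  rewrite (bigD1_seq 2) ?iota_uniq //= -[leLHS]addr0 lerD //.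
    rewrite -exprM mul2n -[leLHS]addr0 lerD ?mulr_ge0 //.
    exact: dickson_ge.
  apply: sumr_ge0 => j _; rewrite -lerBlDr sub0r; exact: dickson_even_ge.
set Sg := \sum_(1 <= j < n) dickson q (lam j) p.+1.*2.
have {}hsum : rho ^+ 2 ^+ p.+1 <= Sg + 2 * Q *+ (n - 1).
  by move: hsum; rewrite big_split sumr_const_nat.
have hn : 2 * Q *+ (n - 1) <= (2 * n)%:R * Q.
  rewrite -mulr_natl natrM mulrA ler_wpM2r // [leLHS]mulrC ler_pM2l //.
  by rewrite ler_nat leq_subr.
move: hsum hn e0; set u := _ *+ (n - 1); set v := (2 * n)%:R * Q.
lra.
Qed.

End Ladder.

(** With [d] the maximum of [b] and [c], the left side is at most (1 + C) d^(p + 1), and the powers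
    of d / x eventually fall below 1 / (1 + C). *)
Lemma eventually_expr_lt (R : realType) (b c x C : R) (M : nat) :
  0 <= b < x -> 0 <= c < x -> 0 <= C ->
  exists2 p, (M <= p)%N & b ^+ p.+1 + C * c ^+ p.+1 < x ^+ p.+1.
Proof.
move=> /andP[b0 bx] /andP[c0 cx] C0.
pose d := Num.max b c.
have d0 : 0 <= d by rewrite le_max b0.
have dx : d < x by rewrite gt_max bx.
have x0 : 0 < x by exact: le_lt_trans dx.
have dx0 : 0 <= d / x by rewrite divr_ge0 // ltW.
have := @cvg_expr R (d / x); rewrite ger0_norm //.
rewrite ltr_pdivrMr // mul1r => /(_ dx) /cvgr0Pnorm_lt /(_ (1 + C)^-1).
have C1 : 0 < 1 + C by lra.
rewrite invr_gt0 => /(_ C1) [N _ hN].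
exists (maxn M N); first exact: leq_maxl.
set p := maxn M N; have := hN p.+1; rewrite /= => /(_ _).
have Np : (N <= p.+1)%N by rewrite leqW // leq_maxr.
move=> /(_ Np); rewrite ger0_norm ?exprn_ge0 //.
rewrite expr_div_n ltr_pdivrMr ?exprn_gt0 // mulrC ltr_pdivlMr // => h.
apply: le_lt_trans h; rewrite mulrDr mulr1 [d ^+ _ * C]mulrC.
apply: lerD; last apply: ler_wpM2l => //.
  by apply: lerXn2r; rewrite ?nnegrE // le_max lexx.
by apply: lerXn2r; rewrite ?nnegrE // le_max lexx orbT.
Qed.

Lemma ladder_connected k r : graph_connected (trivial_groups (mobius_ladder k r)).
Proof.
split; first by exists; exact: (0 : 'Z_(4 * k.+1)).
move=> x y.
have walk (i : nat) (v : 'Z_(4 * k.+1)) : exists p,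
    @is_walk (trivial_groups (mobius_ladder k r)) v p (v + i%:R).
  elim: i v => [|i IH] v; first by exists [::]; rewrite /= addr0.
  have [p wp] := IH (v + 1); exists ((v, inl true) :: p); split=> //.
  by rewrite -natr1 (addrC i%:R) addrA.
have [p wp] := walk (val ((y : 'Z_(4 * k.+1)) - x)) x; exists p.
by rewrite natr_Zp addrC subrK in wp.
Qed.

Lemma ladder_N (R : realType) k r (v0 : fin_vert (mobius_ladder k r)) m :
  @N (trivial_groups (mobius_ladder k r)) v0 R m.+1 =
  (cyclic_walks (mobius_ladder k r) m.+1)%:R%:E.
Proof.
by apply: N_trivial_groups => // a; have [_] := ladder_connected k r; apply.
Qed.

(** The distance to 1 is bounded by a geometric sequence of ratio rho / a < 1. *)
Lemma cvg_ratio (R : realType) (w : nat -> R) (a rho C : R) :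
  0 <= rho < a -> (forall m, `|w m.+1 - a ^+ m.+1| <= C * rho ^+ m.+1) ->
  w m / a ^+ m @[m --> \oo] --> (1 : R).
Proof.
move=> /andP[rho0 rhoa] hw.
have a0 : 0 < a by exact: le_lt_trans rhoa.
have dx0 : 0 <= rho / a by rewrite divr_ge0 // ltW.
have z1 : `|rho / a| < 1 by rewrite ger0_norm // ltr_pdivrMr // mul1r.
rewrite -cvg_shiftS; apply/cvgrPdist_lt => e e0.
have /cvgr0Pnorm_lt /(_ e e0) : geometric C (rho / a) m.+1 @[m --> \oo] --> (0 : R).
  by rewrite (cvg_shiftS (geometric C (rho / a))); exact: cvg_geometric.
apply: filterS => m h; apply: le_lt_trans h; rewrite /geometric /=.
have am : 0 < a ^+ m.+1 by exact: exprn_gt0.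
rewrite distrC -[X in `|_ - X|](divff (lt0r_neq0 am)) -mulrBl normrM.
have ai : 0 <= (a ^+ m.+1)^-1 by rewrite invr_ge0 ltW.
rewrite (ger0_norm ai).
apply: (le_trans _ (ler_norm _)); rewrite expr_div_n mulrA ler_pM2r ?invr_gt0 //.
Qed.

Theorem corollary1p4 (R : realType) (q : nat) (hq : (2 <= q)%N)
    (eps : R) (heps : 0 < eps) :
  exists (X : graph_of_groups) (v0 : vert X),
    [/\ graph_connected X,
        regular q.+1 v0,
        ((N v0 R m * ((q%:R ^+ m)^-1)%:E)%E @[m --> \oo] --> 1%E) &
        forall M : nat, exists2 m : nat, (M <= m)%N &
          (((q%:R - eps) ^+ m)%:E < `|N v0 R m - (q%:R ^+ m)%:E|)%E].
Proof.
(* Here r = q - 1 is the number of parallel edges between antipodes. *)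
case: q hq => // r; rewrite ltnS => r_gt0.
set q := r.+1; set e := Num.min eps q%:R.
have q2 : 2 <= q%:R :> R by rewrite (ler_nat _ 2).
have e0 : 0 < e by rewrite lt_min heps; lra.
have eq : e <= q%:R by rewrite ge_min lexx orbT.
pose s : R := Num.sqrt q%:R.
have s2 : s ^+ 2 = q%:R by rewrite sqr_sqrtr.
have s0 : 0 <= s by exact: sqrtr_ge0.
have sq : s < q%:R by nra.
pose t := Num.max (q%:R - e) s.
have te : q%:R - e <= t by rewrite le_max lexx.
have ts : s <= t by rewrite le_max lexx orbT.
have tq : t < q%:R by rewrite gt_max sq andbT; lra.
(* Halfway between [t] and [q]: above both q - e and sqrt q, and below [q]. *)
pose rho := (t + q%:R) / 2.
have rho_gt : t < rho by rewrite /rho; lra.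
have rho_lt : rho < q%:R by rewrite /rho; lra.
have rho1 : 1 < rho by nra.
(* The target stays below the top eigenvalue q + 1, the gap being (q - rho)(rho - 1) / rho, so a
   long enough ladder reaches it. *)
have [|k hk] := @ladder_eigenvalue2_ge R r (rho + q%:R / rho).
  have -> : r.+2%:R = q%:R + 1 :> R by rewrite natr1.
  rewrite -subr_gt0 (_ : _ - _ = (q%:R - rho) * (rho - 1) / rho).
    by rewrite divr_gt0 ?mulr_gt0 //; lra.
  by field; lra.
exists (trivial_groups (mobius_ladder k r)), (0 : 'Z_(4 * k.+1)); split.
- exact: ladder_connected.
- by apply: regular_trivial => a; exact: ladder_regular.
- have [rh [C [rh0 rhq hC]]] := cyclic_walks_upper R k r_gt0.
  rewrite -cvg_shiftS.
  under eq_fun => m do rewrite /= ladder_N -EFinM.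
  apply: cvg_EFin; first exact: nearW.
  have := @cvg_ratio R (fun m => (cyclic_walks (mobius_ladder k r) m)%:R) _ _ C _ hC.
  by rewrite -cvg_shiftS; apply; rewrite rh0.
(* If eps > q, the base is negative, and any odd exponent makes the left side negative. *)
- move=> M; have [e_le|e_gt] := leP eps q%:R; last first.
    exists M.*2.+1; first by rewrite -addnn leqW // leq_addr.
    apply: lt_le_trans (abse_ge0 _); rewrite lte_fin.
    by rewrite exprn_odd_lt0 ?subr_lt0 //= odd_double.
  have ee : e = eps by rewrite /e min_l.
  (* At the exponent 2(p + 1) powers of squares are compared: the square of q - eps and [q] itself
     lie below that of [rho], and the constant is the one lost in [cyclic_walks_lower]. *)
  have [|||p Mp hp] := @eventually_expr_lt R ((q%:R - eps) ^+ 2) q%:R (rho ^+ 2)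
      (2 * (4 * k.+1))%:R M.
  + rewrite sqr_ge0 /= ltr_pXn2r // ?nnegrE; lra.
  + rewrite ler0n /= -s2 ltr_pXn2r // ?nnegrE; lra.
  + by rewrite ler0n.
  exists p.+1.*2.
    by apply: leq_trans Mp _; rewrite -addnn addSn leqW // leq_addr.
  rewrite doubleS ladder_N -doubleS -EFinB abse_EFin lte_fin.
  apply: lt_le_trans (ler_norm _).
  have -> : (q%:R - eps) ^+ p.+1.*2 = (q%:R - eps) ^+ 2 ^+ p.+1.
    by rewrite -exprM mul2n.
  have rho2 : q%:R <= rho ^+ 2 by rewrite -s2 ler_pXn2r // ?nnegrE; lra.
  have rho_gt0 : 0 < rho by lra.
  apply: lt_le_trans (cyclic_walks_lower r_gt0 p rho_gt0 rho2 hk).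
  by rewrite ltrBrDr.
Qed.
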